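(* For every computable time bound $t$ there is a constant $d_t$ such that $R_K\notin \text{i.o.-DTIME}(t)/2^{n-d_t}$.
   Context: Fix a universal Turing machine $U$; $K(x)=\min\{|p| : U(p)=x\}$ and $R_K=\{x\in\{0,1\}^* : K(x)\ge |x|\}$. For a set $A$, $A^{=n}=A\cap\{0,1\}^n$. Advice computation: a machine $M$ gets input $(x,\alpha(|x|))$, has random access to its input (so the advice may be longer than the running time), and its running time is measured as a function of $|x|$. $L\in\text{i.o.-DTIME}(t)/f$ means there exist a Turing machine $M$ that on every input $(x,\beta)$ runs in time $t(|x|)$, and an advice function $\alpha:\mathbb N\to\{0,1\}^*$ with $|\alpha(n)|\le f(n)$, such that for infinitely many $n$, $L^{=n}=\{x\in\{0,1\}^n : M(x,\alpha(n))\text{ accepts}\}$. *)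

(* Defs.v *)
From mathcomp Require Import all_boot.
Set Implicit Arguments. Unset Strict Implicit. Unset Printing Implicit Defensive.

(* A concrete machine model: Turing machines with one (two-way infinite)    *)
(* work tape over {0,1,blank} and RANDOM ACCESS to two read-only inputs     *)
(* x and beta (the advice).  Random access is realised by two address       *)
(* registers r1, r2 : nat (updated per step by r := 2r+b or r := 0); at     *)
(* every step the machine sees the bit x[r1] and beta[r2] (or "blank" if    *)
(* the address is out of range).  Finitely many states (a finType).         *)

Inductive move := MoveL | MoveR | Stay.
Inductive regop := RKeep | RPush of bool | RReset.

Record tape := Tape { tleft : seq (option bool); thead : option bool;
                      tright : seq (option bool) }.

Definition blank_tape : tape := Tape [::] None [::].

Definition tape_write (tp : tape) (s : option bool) : tape :=
  Tape (tleft tp) s (tright tp).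

Definition tape_move (m : move) (tp : tape) : tape :=
  match m with
  | MoveL => match tleft tp with
             | [::] => Tape [::] None (thead tp :: tright tp)
             | a :: l => Tape l a (thead tp :: tright tp)
             end
  | MoveR => match tright tp with
             | [::] => Tape (thead tp :: tleft tp) None [::]
             | a :: r => Tape (thead tp :: tleft tp) a r
             end
  | Stay => tp
  end.

Definition reg_apply (o : regop) (a : nat) : nat :=
  match o with RKeep => a | RPush b => a.*2 + b | RReset => 0 end.

Definition read_at (s : seq bool) (i : nat) : option bool :=
  if i < size s then Some (nth false s i) else None.

(* A machine: on (state, work symbol, x[r1], beta[r2]) it either halts with
   an accept/reject flag (inl) or performs a move (inr). *)
Record TM := mkTM {
  tm_state : finType;
  tm_start : tm_state;
  tm_delta : tm_state -> option bool -> option bool -> option bool ->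
             bool + (tm_state * option bool * move * regop * regop)
}.

Record config (M : TM) := Cfg { cstate : tm_state M; ctape : tape;
                                 creg1 : nat; creg2 : nat }.

Definition init_cfg (M : TM) : config M := Cfg (tm_start M) blank_tape 0 0.

Fixpoint run (M : TM) (x beta : seq bool) (n : nat) (c : config M)
  : option (bool * tape) :=
  match tm_delta (cstate c) (thead (ctape c)) (read_at x (creg1 c))
                 (read_at beta (creg2 c)) with
  | inl acc => Some (acc, ctape c)
  | inr (q, w, m, o1, o2) =>
      match n with
      | 0 => None
      | n'.+1 => @run M x beta n'
                   (Cfg q (tape_move m (tape_write (ctape c) w))
                        (reg_apply o1 (creg1 c)) (reg_apply o2 (creg2 c)))
      end
  end.

Arguments run : clear implicits.

Fixpoint out_bits (s : seq (option bool)) : seq bool :=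
  match s with
  | Some b :: s' => b :: out_bits s'
  | _ => [::]
  end.

Definition outputs (M : TM) (p y : seq bool) : Prop :=
  exists n acc tp, run M p [::] n (init_cfg M) = Some (acc, tp) /\
                   out_bits (thead tp :: tright tp) = y.

Definition accepts (M : TM) (x beta : seq bool) : Prop :=
  exists n tp, run M x beta n (init_cfg M) = Some (true, tp).

Definition halts_within (M : TM) (x beta : seq bool) (n : nat) : Prop :=
  exists r, run M x beta n (init_cfg M) = Some r.

Definition universal (U : TM) : Prop :=
  forall M : TM, exists c : nat, forall p y : seq bool,
    outputs M p y -> exists q, outputs U q y /\ size q <= size p + c.

(* K_U(x) >= k, i.e. min{|p| : U(p) = x} >= k (min of empty set = infinity) *)
Definition K_ge (U : TM) (x : seq bool) (k : nat) : Prop :=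
  forall p, outputs U p x -> k <= size p.

Definition R_K (U : TM) (x : seq bool) : Prop := K_ge U x (size x).

Definition computable_nat_fun (t : nat -> nat) : Prop :=
  exists M : TM, forall n, outputs M (nseq n true) (nseq (t n) true).

Definition io_DTIME_advice (t f : nat -> nat) (L : seq bool -> Prop) : Prop :=
  exists M : TM,
    (forall x beta, halts_within M x beta (t (size x))) /\
    exists alpha : nat -> seq bool,
      (forall n, size (alpha n) <= f n) /\
      (forall m, exists n, m <= n /\
         forall x : seq bool, size x = n -> (L x <-> accepts M x (alpha n))).

(* Main.v *)
From Pilot Require Import Defs.
From mathcomp Require Import all_boot zify.
From Stdlib Require Import FunctionalExtensionality Classical.
(* [tuple.thead] would otherwise shadow the tape projection [thead]. *)
Import Pilot.Defs.
Set Implicit Arguments. Unset Strict Implicit. Unset Printing Implicit Defensive.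

(* Universality applied to a string-reversing machine yields programs of length
   less than n for all 2^(n-a) strings of length n-a; these programs are lost for the
   strings of length n, so R_K contains at least 2^(n-a) strings of length n.  Hence
   the set of strings of length n accepted by a machine with advice that decides R_K
   at length n has density at least 2^-a.

   A computable procedure can search for a list G of 2^j strings of length
   n = j + 2e that meets every such dense set accepted, within the computable time
   bound, by one of the first 2^(2^(j-a)) - 1 pairs (machine, advice).  Such a list
   exists by the greedy argument: some string belongs to at least a fraction 2^-a of the
   dense sets not met so far.  For n large, a fixed machine with any advice of
   length at most 2^(n-d), where d = 2e+a+2, is among those pairs, so it accepts some
   element of G.  But an element of G is determined by e in unary and an index
   of j bits, hence has complexity at most e + j + O(1) < n if e is large enough,
   and is not in R_K.

   The procedure is obtained from a compiler of primitive recursive expressions, with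
   one unbounded search on top, to machines of the given model, together with an
   arithmetic interpreter for these machines.  The search guesses a number of
   steps after which the machine computing t halts; this number plus one bounds t n. *)

(** * Structured machine fragments *)

(* A fragment leaves by an exit labelled with a boolean, the outcome of a test. *)
Record frag := Frag {
  frag_state : finType;
  frag_start : frag_state;
  frag_delta : frag_state -> option bool -> option bool ->
               (frag_state + bool) * option bool * move * regop
}.

Definition fstep (F : frag) (x : seq bool) (q : frag_state F) (s : tape * nat) :
    (frag_state F + bool) * (tape * nat) :=
  let '(q', w, m, o) := frag_delta q (thead s.1) (read_at x s.2) in
  (q', (tape_move m (tape_write s.1 w), reg_apply o s.2)).

(** An inductive relation rather than a function with fuel: loops compose without step counts, which
    come back only in [steps_run]. *)
Inductive steps (F : frag) (x : seq bool) :
    frag_state F + bool -> tape * nat -> bool -> tape * nat -> Prop :=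
| steps_exit b s : steps x (inr b) s b s
| steps_next q s b s' :
    steps x (fstep x q s).1 (fstep x q s).2 b s' -> steps x (inl q) s b s'.

Definition exec F x s b s' := @steps F x (inl (frag_start F)) s b s'.

(** By induction on the execution: each step of [F] is copied through [phi], and an exit with [b]
    passes control to [kappa b]. The rules for [frag_if] and [frag_while] are instances. *)
Lemma steps_embed (F M : frag) x (phi : frag_state F -> frag_state M)
    (kappa : bool -> frag_state M + bool) :
  (forall q a c, frag_delta (phi q) a c =
     let '(q', w, m, o) := frag_delta q a c in
     (match q' with inl q1 => inl (phi q1) | inr b => kappa b end, w, m, o)) ->
  forall q s b s' b2 s2, @steps F x q s b s' -> steps x (kappa b) s' b2 s2 ->
  steps x (match q with inl q1 => inl (phi q1) | inr b => kappa b end) s b2 s2.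
Proof.
move=> H q s b s' b2 s2; elim=> // {q s b s'} q s b s' _ IH /IH {}IH.
apply: steps_next; rewrite /fstep H; move: IH; rewrite /fstep.
by case: (frag_delta q _ _) => [[[q' w] m] o].
Qed.

Definition frag_atom (f : option bool -> option bool -> bool * option bool * move * regop) :=
  @Frag unit tt (fun _ a c => let '(b, w, m, o) := f a c in (inr b, w, m, o)).

Definition frag_if (F G H : frag) := @Frag (frag_state F + (frag_state G + frag_state H))%type
  (inl (frag_start F))
  (fun q a c => match q with
   | inl q => let '(q', w, m, o) := frag_delta q a c in
       (match q' with inl q1 => inl (inl q1)
        | inr true => inl (inr (inl (frag_start G)))
        | inr false => inl (inr (inr (frag_start H))) end, w, m, o)
   | inr (inl q) => let '(q', w, m, o) := frag_delta q a c in
       (match q' with inl q1 => inl (inr (inl q1)) | inr b => inr b end, w, m, o)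
   | inr (inr q) => let '(q', w, m, o) := frag_delta q a c in
       (match q' with inl q1 => inl (inr (inr q1)) | inr b => inr b end, w, m, o)
   end).

Definition frag_while (F G : frag) := @Frag (frag_state F + frag_state G)%type
  (inl (frag_start F))
  (fun q a c => match q with
   | inl q => let '(q', w, m, o) := frag_delta q a c in
       (match q' with inl q1 => inl (inl q1)
        | inr true => inl (inr (frag_start G))
        | inr false => inr false end, w, m, o)
   | inr q => let '(q', w, m, o) := frag_delta q a c in
       (match q' with inl q1 => inl (inr q1) | inr _ => inl (inl (frag_start F)) end, w, m, o)
   end).

Lemma exec_atom f x s :
  let '(b, w, m, o) := f (thead s.1) (read_at x s.2) in
  exec (frag_atom f) x s b (tape_move m (tape_write s.1 w), reg_apply o s.2).
Proof.
case E: (f _ _) => [[[b w] m] o]; apply: steps_next; rewrite /fstep /= E.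
exact: steps_exit.
Qed.

Lemma exec_if F G H x s b s1 b2 s2 :
  exec F x s b s1 -> exec (if b then G else H) x s1 b2 s2 ->
  exec (frag_if F G H) x s b2 s2.
Proof.
move=> HF HG.
apply: (@steps_embed F (frag_if F G H) x inl
  (fun b => if b then inl (inr (inl (frag_start G)))
            else inl (inr (inr (frag_start H)))) _ _ _ _ _ _ _ HF) => [q a c|] /=.
  by case: (frag_delta q a c) => [[[[q'|[]] w] m] o].
case: b HG {HF} => HG.
- apply: (@steps_embed G (frag_if F G H) x (inr \o inl) inr _ _ _ _ _ _ _ HG); last exact: steps_exit.
  by move=> q a c /=; case: (frag_delta q a c) => [[[[q'|[]] w] m] o].
- apply: (@steps_embed H (frag_if F G H) x (inr \o inr) inr _ _ _ _ _ _ _ HG); last exact: steps_exit.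
  by move=> q a c /=; case: (frag_delta q a c) => [[[[q'|[]] w] m] o].
Qed.

Lemma exec_while_test F G x s b s1 b2 s2 : exec F x s b s1 ->
  steps (F := frag_while F G) x (if b then inl (inr (frag_start G)) else inr false) s1 b2 s2 ->
  exec (frag_while F G) x s b2 s2.
Proof.
move=> HF HG.
apply: (@steps_embed F (frag_while F G) x inl
  (fun b => if b then inl (inr (frag_start G)) else inr false) _ _ _ _ _ _ _ HF HG) => q a c /=.
by case: (frag_delta q a c) => [[[[q'|[]] w] m] o].
Qed.

Lemma exec_while_false F G x s s1 : exec F x s false s1 ->
  exec (frag_while F G) x s false s1.
Proof. move=> /exec_while_test; apply; exact: steps_exit. Qed.

Lemma exec_while_true F G x s s1 b2 s2 b3 s3 :
  exec F x s true s1 -> exec G x s1 b2 s2 ->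
  exec (frag_while F G) x s2 b3 s3 -> exec (frag_while F G) x s b3 s3.
Proof.
move=> /exec_while_test HF HG HW; apply: HF.
apply: (@steps_embed G (frag_while F G) x inr
  (fun b => inl (inl (frag_start F))) _ _ _ _ _ _ _ HG HW) => q a c /=.
by case: (frag_delta q a c) => [[[[q'|[]] w] m] o].
Qed.

Definition frag_TM (F : frag) := @mkTM (frag_state F + bool)%type (inl (frag_start F))
  (fun q a c _ => match q with
   | inl q => let '(q', w, m, o) := frag_delta q a c in inr (q', w, m, o, RKeep)
   | inr b => inl b end).

Lemma steps_run F x q s b s' : @steps F x q s b s' ->
  exists n, run (frag_TM F) x [::] n (Cfg (M := frag_TM F) q s.1 s.2 0) = Some (b, s'.1).
Proof.
elim=> {q s b s'} [b s|q s b s' _ [n IH]]; first by exists 0.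
exists n.+1 => /=; move: IH; rewrite /fstep /=.
by case: (frag_delta _ _ _) => [[[q' w] m] o].
Qed.

(** * The tape as a queue of bits *)

(* The tape is used as a queue: [w] is consumed at its left end and extended at its
   right end, except that a counter in front is incremented by a 1 on the left. *)
Definition wrep (w : seq bool) (tp : tape) := exists a z,
  tleft tp = nseq a None /\ thead tp :: tright tp = map Some w ++ nseq z None.

(** A total-correctness triple on the queue word and the address register. Quantifying over all
    tapes that represent the word hides the number of surrounding blanks. *)
Variant does F x (S : seq bool * nat) b (S' : seq bool * nat) : Prop :=
  Does of forall tp, wrep S.1 tp ->
    exists2 tp', exec F x (tp, S.2) b (tp', S'.2) & wrep S'.1 tp'.

Definition cmd F x S S' := exists b, does F x S b S'.

Lemma does_if F G H x S b S1 b2 S2 :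
  does F x S b S1 -> does (if b then G else H) x S1 b2 S2 -> does (frag_if F G H) x S b2 S2.
Proof.
move=> [HF] [HG]; split=> tp /HF [tp1 E1 /HG [tp2 E2 W2]]; exists tp2 => //.
exact: exec_if E1 E2.
Qed.

Lemma cmd_if F G H x S b S1 S2 :
  does F x S b S1 -> cmd (if b then G else H) x S1 S2 -> cmd (frag_if F G H) x S S2.
Proof. by move=> HF [b2 HG]; exists b2; apply: does_if HF HG. Qed.

Definition frag_seq F G := frag_if F G G.

Lemma does_seq F G x S S1 b S2 :
  cmd F x S S1 -> does G x S1 b S2 -> does (frag_seq F G) x S b S2.
Proof. by move=> [b1 HF] HG; apply: does_if HF _; case: b1. Qed.

Lemma cmd_seq F G x S S1 S2 :
  cmd F x S S1 -> cmd G x S1 S2 -> cmd (frag_seq F G) x S S2.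
Proof. by move=> HF [b HG]; exists b; apply: does_seq HF HG. Qed.

Lemma cmd_while_false F G x S S1 : does F x S false S1 -> cmd (frag_while F G) x S S1.
Proof.
move=> [HF]; exists false; split=> tp /HF [tp1 E1 W1]; exists tp1 => //.
exact: exec_while_false.
Qed.

Arguments cmd_while_false [F G x S S1].

Lemma cmd_while_true F G x S S1 S2 S3 :
  does F x S true S1 -> cmd G x S1 S2 -> cmd (frag_while F G) x S2 S3 ->
  cmd (frag_while F G) x S S3.
Proof.
move=> [HF] [b [HG]] [b' [HW]]; exists b'; split=> tp /HF [tp1 E1 /HG [tp2 E2 /HW [tp3 E3 W3]]].
exists tp3 => //; exact: exec_while_true E1 E2 E3.
Qed.

Definition frag_const b := frag_atom (fun a _ => (b, a, Stay, RKeep)).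

Fixpoint frag_iter n F :=
  if n is n'.+1 then frag_seq F (frag_iter n' F) else frag_const true.

Definition frag_test (f : option bool -> option bool -> bool) :=
  frag_atom (fun a c => (f a c, a, Stay, RKeep)).
Definition frag_reg o := frag_atom (fun a _ => (true, a, Stay, o)).
Definition frag_move m := frag_atom (fun a _ => (true, a, m, RKeep)).
Definition frag_write s := frag_atom (fun _ _ => (true, s, Stay, RKeep)).

Definition nonblank := frag_test (fun a _ => a != None).
Definition is1 := frag_test (fun a _ => a == Some true).
Definition pop := frag_atom (fun _ _ => (true, None, MoveR, RKeep)).
Definition push_front b := frag_seq (frag_move MoveL) (frag_write (Some b)).
Definition push b := frag_seq (frag_while nonblank (frag_move MoveR))
  (frag_seq (frag_write (Some b))
  (frag_seq (frag_while nonblank (frag_move MoveL)) (frag_move MoveR))).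

Lemma tape_writeK tp : tape_write tp (thead tp) = tp.
Proof. by case: tp. Qed.

Lemma does_test f x w r :
  does (frag_test f) x (w, r) (f (ohead w) (read_at x r)) (w, r).
Proof.
split=> tp W; exists tp => //.
have -> : ohead w = thead tp by case: W => a [z [_]] /=; case: w => [|b w] /=; [case: z => // z|]; case=> ->.
have := @exec_atom (fun a c => (f a c, a, Stay, RKeep)) x (tp, r).
by rewrite /= tape_writeK.
Qed.

Lemma does_const b x S : does (frag_const b) x S b S.
Proof.
split=> tp W; exists tp => //.
have := @exec_atom (fun a c => (b, a, Stay, RKeep)) x (tp, S.2).
by rewrite /= tape_writeK.
Qed.

Lemma cmd_reg o x w r : cmd (frag_reg o) x (w, r) (w, reg_apply o r).
Proof.
exists true; split=> tp W; exists tp => //.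
have := @exec_atom (fun a c => (true, a, Stay, o)) x (tp, r).
by rewrite /= tape_writeK.
Qed.

Lemma cmd_pop x a w r : cmd pop x (a :: w, r) (w, r).
Proof.
exists true; split=> tp [y [z [El /= [_ Er]]]].
exists (tape_move MoveR (tape_write tp None)).
  exact: (@exec_atom (fun _ _ => (true, None, MoveR, RKeep)) x (tp, r)).
move: Er; case: tp El => l h t /= -> Et.
exists y.+1; case: t Et => [|c t] Et /=.
  by exists 1; split=> //; case: w Et.
by exists z.
Qed.

Lemma exec_move m x tp r :
  exec (frag_move m) x (tp, r) true (tape_move m tp, r).
Proof.
have := @exec_atom (fun a c => (true, a, m, RKeep)) x (tp, r).
by rewrite /= tape_writeK.
Qed.

Lemma exec_write s x tp r :
  exec (frag_write s) x (tp, r) true (tape_write tp s, r).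
Proof. exact: (@exec_atom (fun _ _ => (true, s, Stay, RKeep)) x (tp, r)). Qed.

Lemma exec_nonblank x tp r : exec nonblank x (tp, r) (thead tp != None) (tp, r).
Proof.
have := @exec_atom (fun a c => (a != None, a, Stay, RKeep)) x (tp, r).
by rewrite /= tape_writeK.
Qed.

Lemma exec_seq F G x s b s1 b2 s2 :
  exec F x s b s1 -> exec G x s1 b2 s2 -> exec (frag_seq F G) x s b2 s2.
Proof. by move=> HF HG; apply: exec_if HF _; case: b. Qed.

Lemma cmd_push_front b x w r : cmd (push_front b) x (w, r) (b :: w, r).
Proof.
exists true; split=> tp [y [z [El Er]]].
exists (tape_write (tape_move MoveL tp) (Some b)).
  exact: exec_seq (exec_move _ _ _ _) (exec_write _ _ _ _).
case: tp El Er => l h t /= -> Er; case: y => [|y] /=.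
  by exists 0, z; rewrite /= Er.
by exists y, z; rewrite /= Er.
Qed.

(** The number [z'] is existential because a move beyond the written cells creates a new blank. *)
Lemma exec_goto_end x r l h t w z :
  h :: t = map Some w ++ nseq z None ->
  exists z', exec (frag_while nonblank (frag_move MoveR)) x (Tape l h t, r) false
    (Tape (map Some (rev w) ++ l) None (nseq z' None), r).
Proof.
elim: w l h t => [|b w IH] l h t.
  case: z => // z [-> ->]; exists z; apply: exec_while_false.
  by have := exec_nonblank x (Tape l None (nseq z None)) r.
move=> [-> Et].
have step z' : exec (frag_while nonblank (frag_move MoveR)) x
     (tape_move MoveR (Tape l (Some b) t), r) false
    (Tape (map Some (rev w) ++ Some b :: l) None (nseq z' None), r) ->
   exec (frag_while nonblank (frag_move MoveR)) x (Tape l (Some b) t, r) false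
    (Tape (map Some (rev (b :: w)) ++ l) None (nseq z' None), r).
  move=> H; rewrite rev_cons map_rcons cat_rcons.
  apply: (exec_while_true (s1 := (Tape l (Some b) t, r)) _ (exec_move _ _ _ _) H).
  exact: (exec_nonblank x (Tape l (Some b) t) r).
case: t Et step => [|c t] Et step.
  case: w {IH} Et step => // _ step; exists 0; apply: step; apply: exec_while_false.
  exact: (exec_nonblank x (Tape (Some b :: l) None [::]) r).
by have [z' /step] := IH (Some b :: l) _ _ Et; exists z'.
Qed.

Lemma exec_goto_start x r y h u v : exists y',
  exec (frag_while nonblank (frag_move MoveL)) x
     (Tape (map Some (rev u) ++ nseq y None) (Some h) v, r) false
     (Tape (nseq y' None) None (map Some u ++ Some h :: v), r).
Proof.
have nb l h' v' := exec_nonblank x (Tape l (Some h') v') r.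
(* Walking left, the head meets the last bit of [u] first, hence the induction from the right. *)
elim/last_ind: u h v => [|u b IH] h v.
  have step := exec_while_true (nb (nseq y None) h v) (exec_move MoveL _ _ _).
  case: y step => [|y] step.
    exists 0; apply: step; apply: exec_while_false.
    exact: (exec_nonblank x (Tape [::] None (Some h :: v)) r).
  exists y; apply: step; apply: exec_while_false.
  exact: (exec_nonblank x (Tape (nseq y None) None (Some h :: v)) r).
have [y' H] := IH b (Some h :: v); exists y'.
rewrite rev_rcons map_rcons cat_rcons.
have step := exec_while_true (nb (Some b :: map Some (rev u) ++ nseq y None) h v) (exec_move MoveL _ _ _).
exact: step H.
Qed.

Lemma cmd_push b x w r : cmd (push b) x (w, r) (rcons w b, r).
Proof.
exists true; split=> -[l h t] [y [z [/= -> Er]]].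
have [z' H1] := exec_goto_end x r (nseq y None) Er.
have [y' H2] := exec_goto_start x r y b w (nseq z' None).
eexists.
  have HW := exec_write (Some b) x (Tape (map Some (rev w) ++ nseq y None) None (nseq z' None)) r.
  exact: (exec_seq H1 (exec_seq HW (exec_seq H2 (exec_move MoveR _ _ _)))).
have -> : map Some w ++ Some b :: nseq z' None = map Some (rcons w b) ++ nseq z' None.
  by rewrite map_rcons cat_rcons.
case E: (rcons w b) => [|c v]; first by case: w E {H1 H2 Er}.
by exists y'.+1, z'.
Qed.

Lemma cmd_iter F x (S : nat -> seq bool * nat) n :
  (forall i, i < n -> cmd F x (S i) (S i.+1)) -> cmd (frag_iter n F) x (S 0) (S n).
Proof.
elim: n S => [|n IH] S H /=; first by exists true; apply: does_const.
apply: cmd_seq (H 0 _) _ => //; apply: (IH (fun i => S i.+1)) => i Hi; exact: H.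
Qed.

(** * Counters and primitive recursive expressions *)

(** In unary with a final 0, the first bit of a block is the zero test, and increment and decrement
    act on the front of the queue only. *)
Definition seg a := rcons (nseq a true) false.
Definition flat (s : seq nat) := flatten (map seg s).
(* Each bit [b] of the output is stored as the block 1[b], and a 0 ends the output. *)
Definition pairs (o : seq bool) := flatten (map (fun b => [:: true; b]) o).
Definition outs o := rcons (pairs o) false.

Definition rot1 := frag_seq (frag_while is1 (frag_seq pop (push true))) (frag_seq pop (push false)).
Definition copy_bit := frag_if is1 (frag_seq pop (push true)) (frag_seq pop (push false)).
Definition copy_pairs := frag_while is1 (frag_seq pop (frag_seq (push true) copy_bit)).
Definition rot_outs := frag_seq copy_pairs (frag_seq pop (push false)).

Lemma does_is1 x w r : does is1 x (w, r) (ohead w == Some true) (w, r).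
Proof. exact: (@does_test (fun a _ => a == Some true)). Qed.

Lemma does_is1_true x w r : does is1 x (true :: w, r) true (true :: w, r).
Proof. exact: does_is1. Qed.

Lemma does_is1_false x w r : does is1 x (false :: w, r) false (false :: w, r).
Proof. exact: does_is1. Qed.

Lemma cmd_rot1 x a w r : cmd rot1 x (seg a ++ w, r) (w ++ seg a, r).
Proof.
rewrite /seg cat_rcons -rcons_cat.
apply: (@cmd_seq _ _ _ _ (false :: w ++ nseq a true, r)); last first.
  exact: cmd_seq (cmd_pop _ _ _ _) (cmd_push _ _ _ _).
have -> : false :: w = false :: w ++ nseq 0 true by rewrite cats0.
rewrite -[in X in cmd _ _ _ X](add0n a); elim: a 0 => [|a IH] i /=.
  rewrite addn0. exact: cmd_while_false (does_is1_false _ _ _).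
apply: cmd_while_true (does_is1_true _ _ _) (cmd_seq (cmd_pop _ _ _ _) (cmd_push _ _ _ _)) _.
rewrite addnS -addSn rcons_cat rcons_cons rcons_cat.
have -> : rcons (nseq i true) true = nseq i.+1 true by elim: (i) => //= j ->.
exact: IH.
Qed.

Lemma cmd_copy_bit x b w r : cmd copy_bit x (b :: w, r) (rcons w b, r).
Proof.
by apply: cmd_if (does_is1 _ _ _) _; case: b => /=;
  apply: cmd_seq (cmd_pop _ _ _ _) (cmd_push _ _ _ _).
Qed.

Lemma cmd_copy_pairs x o w r :
  cmd copy_pairs x (pairs o ++ false :: w, r) (false :: w ++ pairs o, r).
Proof.
elim: o w => [|b o IH] w /=.
  rewrite cats0; exact: cmd_while_false (does_is1_false _ _ _).
apply: (cmd_while_true (does_is1_true _ _ _)).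
  apply: cmd_seq (cmd_pop _ _ _ _) (cmd_seq (cmd_push _ _ _ _) _).
  exact: cmd_copy_bit.
have := IH (rcons (rcons w true) b).
by rewrite /= !cat_rcons -!rcons_cons -!rcons_cat.
Qed.

Lemma cmd_rot_outs x o w r : cmd rot_outs x (outs o ++ w, r) (w ++ outs o, r).
Proof.
rewrite /outs cat_rcons -rcons_cat.
apply: cmd_seq (cmd_copy_pairs _ _ _ _) _.
exact: cmd_seq (cmd_pop _ _ _ _) (cmd_push _ _ _ _).
Qed.

Definition rots n := frag_iter n rot1.

Lemma cmd_rots x s w r : cmd (rots (size s)) x (flat s ++ w, r) (w ++ flat s, r).
Proof.
elim: s w => [|a s IH] w /=; first by rewrite cats0; exists true; apply: does_const.
rewrite /flat /= -/(flat s) -catA; apply: cmd_seq (cmd_rot1 _ _ _ _) _.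
by have := IH (w ++ seg a); rewrite -!catA.
Qed.

Definition upd (f : nat -> nat) i v := fun j => if j == i then v else f j.

Definition st k f o r : seq bool * nat := (flat (mkseq f k) ++ outs o, r).

Lemma st_ext k f g o r : (forall i, i < k -> f i = g i) -> st k f o r = st k g o r.
Proof.
move=> H; congr (flat _ ++ _, _); apply/eq_in_map => i; rewrite mem_iota => /andP[_].
exact: H.
Qed.

Lemma cmd_st_eq F x S k f g o r : cmd F x S (st k f o r) ->
  (forall i, i < k -> f i = g i) -> cmd F x S (st k g o r).
Proof. by move=> H /st_ext <-. Qed.

Lemma mkseq_split (f : nat -> nat) k i : i < k ->
  mkseq f k = mkseq f i ++ f i :: mkseq (fun j => f (i.+1 + j)) (k - i.+1).
Proof.
move=> Hi; have {1}-> : k = i + (k - i.+1).+1 by lia.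
rewrite /mkseq iotaD map_cat /= add0n -[in iota i.+1 _](addn0 i.+1) iotaDl -map_comp.
by rewrite addn0.
Qed.

Lemma flat_cons a s : flat (a :: s) = seg a ++ flat s.
Proof. by []. Qed.

Lemma flat_split s1 a s2 : flat (s1 ++ a :: s2) = flat s1 ++ seg a ++ flat s2.
Proof. by rewrite /flat map_cat flatten_cat. Qed.

(** One full turn of the queue: counter [i] comes to the front, [F] acts there, and the other
    counters and the output block follow, which restores the order. *)
Definition at_reg k i F := frag_seq (rots i) (frag_seq F (frag_seq (rots (k - i)) rot_outs)).
Definition test_reg k i := frag_seq (rots i) (frag_if is1
  (frag_seq (rots (k - i)) (frag_seq rot_outs (frag_const true)))
  (frag_seq (rots (k - i)) (frag_seq rot_outs (frag_const false)))).

Lemma cmd_at_reg k i F x f o r v : i < k ->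
  (forall w, cmd F x (seg (f i) ++ w, r) (seg v ++ w, r)) ->
  cmd (at_reg k i F) x (st k f o r) (st k (upd f i v) o r).
Proof.
move=> Hi HF; rewrite /st !(mkseq_split _ Hi) /at_reg !flat_split -!catA.
set s1 := mkseq f i; set s2 := mkseq _ (k - i.+1).
have -> : mkseq (upd f i v) i = s1.
  apply/eq_in_map => j; rewrite mem_iota => /andP[_ Hj]; rewrite /upd; case: eqP => //; lia.
have -> : mkseq (fun j => upd f i v (i.+1 + j)) (k - i.+1) = s2.
  apply/eq_in_map => j _; rewrite /upd; case: eqP => //; lia.
rewrite {1}/upd eqxx.
have := cmd_rots x s1 (flat (f i :: s2) ++ outs o) r; rewrite {1}size_mkseq flat_cons -!catA => H1.
apply: cmd_seq H1 _.
apply: cmd_seq (HF _) _.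
have := cmd_rots x (v :: s2) (outs o ++ flat s1) r.
rewrite /= size_mkseq subnSK // flat_cons -!catA => H2.
by apply: cmd_seq H2 _; have := cmd_rot_outs x o (flat s1 ++ seg v ++ flat s2) r; rewrite -!catA.
Qed.

Lemma does_test_reg k i x f o r : i < k ->
  does (test_reg k i) x (st k f o r) (f i != 0) (st k f o r).
Proof.
move=> Hi; rewrite /st !(mkseq_split _ Hi) !flat_split -!catA.
set s1 := mkseq f i; set s2 := mkseq _ (k - i.+1).
have := cmd_rots x s1 (flat (f i :: s2) ++ outs o) r; rewrite {1}size_mkseq flat_cons -!catA => H1.
apply: does_seq H1 _.
apply: does_if (does_is1 _ _ _) _.
have -> : (ohead (seg (f i) ++ flat s2 ++ outs o ++ flat s1) == Some true) = (f i != 0).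
  by rewrite /seg; case: (f i).
have := cmd_rots x (f i :: s2) (outs o ++ flat s1) r.
rewrite /= size_mkseq subnSK // flat_cons -!catA => H2.
have := cmd_rot_outs x o (flat s1 ++ seg (f i) ++ flat s2) r; rewrite -!catA => H3.
by case: (f i != 0); apply: does_seq H2 (does_seq H3 (does_const _ _ _)).
Qed.

Definition inc k i := at_reg k i (push_front true).
Definition dec k i := at_reg k i pop.

Lemma cmd_inc k i x f o r : i < k ->
  cmd (inc k i) x (st k f o r) (st k (upd f i (f i).+1) o r).
Proof. move=> Hi; apply: cmd_at_reg => // w; exact: cmd_push_front. Qed.

Lemma cmd_dec k i x f o r v : i < k -> f i = v.+1 ->
  cmd (dec k i) x (st k f o r) (st k (upd f i v) o r).
Proof. move=> Hi E; apply: cmd_at_reg => // w; rewrite E; exact: cmd_pop. Qed.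

Ltac upds := rewrite /upd; repeat (case: eqP => ?); subst; try lia.

Definition clear k i := frag_while (test_reg k i) (dec k i).

Lemma cmd_clear k i x f o r : i < k ->
  cmd (clear k i) x (st k f o r) (st k (upd f i 0) o r).
Proof.
move=> Hi; move E: (f i) => v; elim: v f E => [|v IH] f E.
  rewrite (@st_ext k (upd f i 0) f); last by move=> j Hj; upds.
  have := @does_test_reg k i x f o r Hi; rewrite E; exact: cmd_while_false.
have := @does_test_reg k i x f o r Hi; rewrite E => HT.
apply: cmd_while_true HT (cmd_dec _ _ _ Hi E) _.
rewrite (@st_ext k (upd f i 0) (upd (upd f i v) i 0)); last by move=> j Hj; upds.
by apply: IH; upds.
Qed.

Definition mv k a b := frag_while (test_reg k a) (frag_seq (dec k a) (inc k b)).

Lemma cmd_mv k a b x f o r : a < k -> b < k -> a <> b ->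
  cmd (mv k a b) x (st k f o r) (st k (upd (upd f b (f b + f a)) a 0) o r).
Proof.
move=> Ha Hb Hab; move E: (f a) => v; elim: v f E => [|v IH] f E.
  rewrite (@st_ext k (upd _ _ _) f); last by move=> j Hj; upds.
  have := @does_test_reg k a x f o r Ha; rewrite E; exact: cmd_while_false.
have := @does_test_reg k a x f o r Ha; rewrite E => HT.
apply: cmd_while_true HT (cmd_seq (cmd_dec _ _ _ Ha E) (cmd_inc _ _ _ _ Hb)) _.
set g := upd (upd f a v) b _.
rewrite (@st_ext k (upd (upd f b _) a 0) (upd (upd g b (g b + v)) a 0)); last by rewrite /g => j Hj; upds.
by apply: IH; rewrite /g; upds.
Qed.

(** Reading a counter destroys it, so its value is also saved in the scratch counter [c] and then
    moved back; this is why [c] must start at 0. *)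
Definition copy k a b c := frag_seq
  (frag_while (test_reg k a) (frag_seq (dec k a) (frag_seq (inc k b) (inc k c)))) (mv k c a).

Lemma cmd_copy k a b c x f o r : a < k -> b < k -> c < k -> a <> b -> a <> c -> b <> c ->
  f c = 0 -> cmd (copy k a b c) x (st k f o r) (st k (upd f b (f b + f a)) o r).
Proof.
move=> Ha Hb Hc Hab Hac Hbc E0.
have H : cmd (frag_while (test_reg k a) (frag_seq (dec k a) (frag_seq (inc k b) (inc k c))))
  x (st k f o r) (st k (upd (upd (upd f b (f b + f a)) c (f c + f a)) a 0) o r).
  move E: (f a) => v {E0}; elim: v f E => [|v IH] f E.
    rewrite (@st_ext k (upd _ _ _) f); last by move=> j Hj; upds.
    have := @does_test_reg k a x f o r Ha; rewrite E; exact: cmd_while_false.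
  have := @does_test_reg k a x f o r Ha; rewrite E => HT.
  apply: cmd_while_true HT (cmd_seq (cmd_dec _ _ _ Ha E)
    (cmd_seq (cmd_inc _ _ _ _ Hb) (cmd_inc _ _ _ _ Hc))) _.
  set g := upd (upd (upd f a v) b _) c _.
  rewrite (@st_ext k (upd (upd (upd f b _) c _) a 0) (upd (upd (upd g b (g b + v)) c (g c + v)) a 0)); last by rewrite /g => j Hj; upds.
  by apply: IH; rewrite /g; upds.
apply: cmd_seq H _.
set g := upd _ a 0.
apply: cmd_st_eq (cmd_mv _ _ _ _ Hc Ha (nesym Hac)) _.
by rewrite /g => j Hj; upds.
Qed.

(* [Rec en ez es] recurses [n] times from [ez]; besides the index and the accumulator,
   [es] sees the remaining number of steps, which is an artefact of the compilation. *)
Inductive expr :=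
| Var of nat
| Zero
| Succ of expr
| Let of expr & expr
| Rec of expr & expr & expr.

Definition scons (a : nat) (e : nat -> nat) : nat -> nat :=
  fun i => if i is j.+1 then e j else a.

Fixpoint eval (e : expr) (s : nat -> nat) : nat :=
  match e with
  | Var i => s i
  | Zero => 0
  | Succ e => (eval e s).+1
  | Let e1 e2 => eval e2 (scons (eval e1 s) s)
  | Rec en ez es =>
      let n := eval en s in
      iteri n (fun i a => eval es (scons i (scons a (scons (n - i.+1) s))))
        (eval ez (scons n s))
  end.

(** How many counters, from the top of the stack on, the compiled code may touch. A variable takes
    two because [copy] needs a scratch counter. *)
Fixpoint height e := match e with
  | Var _ => 2
  | Zero => 1
  | Succ e => height e
  | Let e1 e2 => maxn (height e1) (height e2).+1
  | Rec en ez es => maxn (height en) (maxn (height ez).+1 (height es).+3)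
  end.

Lemma height_gt0 e : 0 < height e.
Proof. elim: e => //= *; lia. Qed.

(* Stack discipline: counters below [m] hold the environment, with index 0 on top,
   those from [m] on are zero, and the value is left in counter [m]. *)
Fixpoint compile k e m := match e with
  | Var i => if i < m then copy k (m - i.+1) m m.+1 else frag_const true
  | Zero => frag_const true
  | Succ e => frag_seq (compile k e m) (inc k m)
  | Let e1 e2 => frag_seq (compile k e1 m) (frag_seq (compile k e2 m.+1)
      (frag_seq (clear k m) (mv k m.+1 m)))
  | Rec en ez es => frag_seq (compile k en m) (frag_seq (compile k ez m.+1)
      (frag_seq (frag_while (test_reg k m)
         (frag_seq (dec k m) (frag_seq (compile k es m.+3)
         (frag_seq (clear k m.+1) (frag_seq (mv k m.+3 m.+1) (inc k m.+2))))))
      (frag_seq (clear k m.+2) (mv k m.+1 m))))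
  end.

Definition env (f : nat -> nat) m := fun i => if i < m then f (m - i.+1) else 0.

Lemma env_upd f m v : env (upd f m v) m.+1 = scons v (env f m).
Proof.
apply: functional_extensionality => -[|i]; rewrite /env /upd /=.
  by rewrite subn1 /= eqxx.
by rewrite ltnS subSS; case: ltnP => // H; case: eqP => //; lia.
Qed.

Lemma cmd_compile k x o r e m f : m + height e <= k ->
  (forall i, m <= i < k -> f i = 0) ->
  cmd (compile k e m) x (st k f o r) (st k (upd f m (eval e (env f m))) o r).
Proof.
elim: e m f => [i||e IH|e1 IH1 e2 IH2|en IHn ez IHz es IHs] m f /= Hk Hf.
- rewrite {1}/env; case: ltnP => Hi.
    apply: cmd_st_eq (cmd_copy _ _ _ _ _ _ _ _ _ _) _; try lia; first by apply: Hf; lia.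
    by move=> j Hj; upds; rewrite Hf //; lia.
  rewrite (@st_ext k (upd _ _ _) f); first by exists true; apply: does_const.
  by move=> j Hj; upds; rewrite Hf //; lia.
- rewrite (@st_ext k (upd _ _ _) f); first by exists true; apply: does_const.
  by move=> j Hj; upds; rewrite Hf //; lia.
- have Hh := height_gt0 e.
  have H1 := IH m f Hk Hf.
  have H2 : m < k by lia.
  apply: cmd_seq H1 _; set v := eval e _.
  apply: cmd_st_eq (cmd_inc _ _ _ _ H2) _.
  by move=> j Hj; upds.
- have Hh := height_gt0 e2.
  have H1 := IH1 m f; apply: cmd_seq (H1 _ _) _ => // {H1}; first lia.
  set v1 := eval e1 _.
  have H2 := IH2 m.+1 (upd f m v1); apply: cmd_seq (H2 _ _) _ => // {H2}; first lia.
    by move=> i Hi; upds; apply: Hf; lia.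
  rewrite env_upd; set v2 := eval e2 _.
  apply: cmd_seq (cmd_clear _ _ _ _ _) _; first lia.
  set g := upd _ m 0.
  apply: cmd_st_eq (cmd_mv _ _ _ _ _ _ _) _; try lia.
  by move=> j Hj; rewrite /g; upds; rewrite Hf //; lia.
- have Hh := height_gt0 es.
  have H1 := IHn m f; apply: cmd_seq (H1 _ _) _ => // {H1}; first lia.
  set n := eval en _.
  have H2 := IHz m.+1 (upd f m n); apply: cmd_seq (H2 _ _) _ => // {H2}; first lia.
    by move=> i Hi; upds; apply: Hf; lia.
  rewrite env_upd; set z := eval ez _.
  pose F i a := eval es (scons i (scons a (scons (n - i.+1) (env f m)))).
  (* Loop invariant: counters [m], [m.+1], [m.+2] hold the remaining steps, the accumulator and the
     index. *)
  pose inv i a := upd (upd (upd f m (n - i)) m.+1 a) m.+2 i.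
  rewrite (@st_ext k _ (inv 0 z)); last first.
    by move=> j Hj; rewrite /inv; upds; rewrite Hf //; lia.
  have HT i a : does (test_reg k m) x (st k (inv i a) o r) (n - i != 0) (st k (inv i a) o r).
    have Em : inv i a m = n - i by rewrite /inv; upds.
    have Hm : m < k by lia.
    by rewrite -Em; apply: does_test_reg.
  have HW j i : n = i + j ->
    cmd (frag_while (test_reg k m)
         (frag_seq (dec k m) (frag_seq (compile k es m.+3)
         (frag_seq (clear k m.+1) (frag_seq (mv k m.+3 m.+1) (inc k m.+2))))))
     x (st k (inv i (iteri i F z)) o r) (st k (inv n (iteri n F z)) o r).
    elim: j i => [|j IHj] i En.
      have -> : i = n by lia.
      by have := HT n (iteri n F z); rewrite subnn; apply: cmd_while_false.
    have := HT i (iteri i F z).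
    have -> : n - i != 0 by lia.
    move=> H; apply: cmd_while_true H _ (IHj i.+1 _); last lia.
    have Hm : m < k by lia.
    (* The decrement precedes the body, so the body sees [n - i.+1] as the remaining number of
       steps. *)
    apply: cmd_seq (@cmd_dec k m x _ o r (n - i.+1) Hm _) _.
      by rewrite /inv; upds.
    set a := iteri i F z.
    rewrite (@st_ext k _ (upd (upd (upd f m (n - i.+1)) m.+1 a) m.+2 i)); last first.
      by move=> l Hl; rewrite /inv; upds.
    set g := upd _ m.+2 i.
    have H3 := IHs m.+3 g; apply: cmd_seq (H3 _ _) _ => //; first lia.
      by move=> l Hl; rewrite /g; upds; apply: Hf; lia.
    rewrite /g !env_upd -/(F i a) -/g.
    have Hm1 : m.+1 < k by lia.
    have Hm2 : m.+2 < k by lia.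
    apply: cmd_seq (cmd_clear _ _ _ _ Hm1) _.
    apply: cmd_seq (cmd_mv _ _ _ _ _ _ _) _; try lia.
    set h := upd _ m.+3 0.
    apply: cmd_st_eq (cmd_inc _ _ _ _ Hm2) _.
    move=> l Hl; rewrite /h /g /inv /= -/a.
    by upds; rewrite ?Hf //; lia.
  apply: cmd_seq (HW n 0 _) _ => //.
  have Hm2 : m.+2 < k by lia.
  apply: cmd_seq (cmd_clear _ _ _ _ Hm2) _.
  set g := upd _ m.+2 0.
  apply: cmd_st_eq (cmd_mv _ _ _ _ _ _ _) _; try lia.
  move=> l Hl; rewrite /g /inv.
  upds; rewrite ?Hf //; try lia; rewrite ?subnn ?add0n //; lia.
Qed.

(** * Renaming of variables and closure properties of primitive recursion *)

Definition up (xi : nat -> nat) i := if i is j.+1 then (xi j).+1 else 0.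

Fixpoint ren (xi : nat -> nat) e := match e with
  | Var i => Var (xi i)
  | Zero => Zero
  | Succ e => Succ (ren xi e)
  | Let e1 e2 => Let (ren xi e1) (ren (up xi) e2)
  | Rec en ez es => Rec (ren xi en) (ren (up xi) ez) (ren (up (up (up xi))) es)
  end.

Lemma scons_up a xi s : (fun i => scons a s (up xi i)) = scons a (fun i => s (xi i)).
Proof. by apply: functional_extensionality => -[]. Qed.

Lemma eval_ren xi e s : eval (ren xi e) s = eval e (fun i => s (xi i)).
Proof.
elim: e xi s => //= [e IH|e1 IH1 e2 IH2|en IHn ez IHz es IHs] xi s.
- by rewrite IH.
- by rewrite IH2 IH1 scons_up.
- rewrite IHn IHz scons_up; elim: {1 4}(eval en _) => //= n ->.
  by rewrite IHs !scons_up.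
Qed.

(** Functions take a whole environment, with the innermost variable at index 0, so no arities have
    to be tracked. *)
Definition PR (f : (nat -> nat) -> nat) := exists e, forall s, eval e s = f s.

Lemma pr_ext f g : PR f -> f =1 g -> PR g.
Proof. by move=> [e He] H; exists e => s; rewrite He. Qed.

Lemma pr_ren xi f : PR f -> PR (fun s => f (fun i => s (xi i))).
Proof. by move=> [e He]; exists (ren xi e) => s; rewrite eval_ren. Qed.

Lemma pr_var i : PR (fun s => s i).
Proof. by exists (Var i). Qed.

Lemma pr_succ f : PR f -> PR (fun s => (f s).+1).
Proof. by move=> [e He]; exists (Succ e) => s /=; rewrite He. Qed.

Lemma pr_const n : PR (fun _ => n).
Proof. by elim: n => [|n /pr_succ //]; exists Zero. Qed.

Lemma pr_let f g : PR f -> PR g -> PR (fun s => g (scons (f s) s)).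
Proof. by move=> [e He] [e' He']; exists (Let e e') => s /=; rewrite He. Qed.

Lemma pr_comp1 G f : PR (fun s => G (s 0)) -> PR f -> PR (fun s => G (f s)).
Proof. by move=> HG Hf; have := pr_let Hf HG. Qed.

(** The arguments are bound one after the other by [Let]; the renaming [S] makes the second one skip
    the value already pushed. *)
Lemma pr_comp2 G f g : PR (fun s => G (s 0) (s 1)) -> PR f -> PR g ->
  PR (fun s => G (f s) (g s)).
Proof. by move=> HG Hf Hg; have := pr_let Hg (pr_let (pr_ren S Hf) HG). Qed.

Lemma pr_comp3 G f g h : PR (fun s => G (s 0) (s 1) (s 2)) -> PR f -> PR g -> PR h ->
  PR (fun s => G (f s) (g s) (h s)).
Proof.
by move=> HG Hf Hg Hh; have := pr_let Hh (pr_let (pr_ren S Hg) (pr_let (pr_ren (fun i => i.+2) Hf) HG)).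
Qed.

Lemma pr_comp4 G f g h k : PR (fun s => G (s 0) (s 1) (s 2) (s 3)) ->
  PR f -> PR g -> PR h -> PR k -> PR (fun s => G (f s) (g s) (h s) (k s)).
Proof.
move=> HG Hf Hg Hh Hk.
by have := pr_let Hk (pr_let (pr_ren S Hh) (pr_let (pr_ren (fun i => i.+2) Hg)
  (pr_let (pr_ren (fun i => i.+3) Hf) HG))).
Qed.

Lemma pr_iteri n z (F : (nat -> nat) -> nat -> nat -> nat) :
  PR n -> PR z -> PR (fun s => F (fun i => s i.+2) (s 0) (s 1)) ->
  PR (fun s => iteri (n s) (F s) (z s)).
Proof.
(* The renaming [up (up S)] hides the remaining number of steps from the body, and [S] hides it from
   the base case. *)
move=> [en Hn] /(pr_ren S) [ez Hz] /(pr_ren (up (up S))) [es Hs].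
exists (Rec en ez es) => s /=; rewrite Hn Hz /=; elim: {1 3}(n s) => //= i ->.
exact: Hs.
Qed.

Lemma iter_iteri T n (F : T -> T) z : iter n F z = iteri n (fun _ => F) z.
Proof. by elim: n => //= n ->. Qed.

Lemma pr_iter n z (F : (nat -> nat) -> nat -> nat) :
  PR n -> PR z -> PR (fun s => F (fun i => s i.+1) (s 0)) ->
  PR (fun s => iter (n s) (F s) (z s)).
Proof.
move=> Hn Hz HF; apply: (@pr_ext (fun s => iteri (n s) (fun _ => F s) (z s))).
  by apply: (@pr_iteri n z (fun s _ => F s)) => //; apply: (pr_ren S HF).
by move=> s; rewrite -iter_iteri.
Qed.

Lemma pr_pred f : PR f -> PR (fun s => (f s).-1).
Proof.
move=> Hf; apply: (pr_comp1 (G := fun n => n.-1)) Hf.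
apply: (@pr_ext (fun s => iteri (s 0) (fun i _ => i) 0)); last by move=> s; case: (s 0).
exact: (@pr_iteri _ _ (fun _ i _ => i)) (pr_var _) (pr_const _) (pr_var _).
Qed.

Lemma pr_add f g : PR f -> PR g -> PR (fun s => f s + g s).
Proof.
move=> Hf Hg; apply: (@pr_ext (fun s => iter (f s) succn (g s))).
  by apply: (@pr_iter _ _ (fun _ a => a.+1)) => //; apply: pr_succ (pr_var _).
by move=> s; rewrite iter_succn addnC.
Qed.

Lemma pr_sub f g : PR f -> PR g -> PR (fun s => f s - g s).
Proof.
move=> Hf Hg; apply: (@pr_ext (fun s => iter (g s) predn (f s))).
  by apply: (@pr_iter _ _ (fun _ a => a.-1)) => //; apply: pr_pred (pr_var _).
by move=> s; rewrite iter_predn.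
Qed.

Lemma pr_mul f g : PR f -> PR g -> PR (fun s => f s * g s).
Proof.
move=> Hf Hg; apply: (@pr_ext (fun s => iter (f s) (addn (g s)) 0)).
  apply: (@pr_iter _ _ (fun s a => g s + a)) => //; first exact: pr_const.
  exact: pr_add (pr_ren S Hg) (pr_var _).
by move=> s; rewrite iter_addn_0 mulnC.
Qed.

Lemma pr_exp f g : PR f -> PR g -> PR (fun s => f s ^ g s).
Proof.
move=> Hf Hg; apply: (@pr_ext (fun s => iter (g s) (muln (f s)) 1)).
  apply: (@pr_iter _ _ (fun s a => f s * a)) => //; first exact: pr_const.
  exact: pr_mul (pr_ren S Hf) (pr_var _).
by move=> s; rewrite iter_muln_1.
Qed.

Lemma pr_not (b : (nat -> nat) -> bool) : PR b -> PR (fun s => ~~ b s).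
Proof.
move=> Hb; apply: (@pr_ext (fun s => 1 - b s)); first exact: pr_sub (pr_const _) Hb.
by move=> s; case: (b s).
Qed.

Lemma pr_and (b c : (nat -> nat) -> bool) : PR b -> PR c -> PR (fun s => b s && c s).
Proof.
move=> Hb Hc; apply: (@pr_ext (fun s => b s * c s)); first exact: pr_mul.
by move=> s; case: (b s); case: (c s).
Qed.

Lemma pr_imp (b c : (nat -> nat) -> bool) : PR b -> PR c -> PR (fun s => b s ==> c s).
Proof.
move=> Hb Hc; apply: (@pr_ext (fun s => ~~ (b s && ~~ c s))).
  exact: pr_not (pr_and Hb (pr_not Hc)).
by move=> s; case: (b s); case: (c s).
Qed.

Lemma pr_leq f g : PR f -> PR g -> PR (fun s => f s <= g s).
Proof.
move=> Hf Hg; apply: (@pr_ext (fun s => 1 - (f s - g s))).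
  exact: pr_sub (pr_const _) (pr_sub Hf Hg).
move=> s /=; lia.
Qed.

Lemma pr_eqn f g : PR f -> PR g -> PR (fun s => f s == g s).
Proof.
move=> Hf Hg; apply: (@pr_ext (fun s => (f s <= g s) && (g s <= f s))).
  by apply: pr_and; apply: pr_leq.
by move=> s /=; rewrite -eqn_leq.
Qed.

Lemma pr_if (b : (nat -> nat) -> bool) f g :
  PR b -> PR f -> PR g -> PR (fun s => if b s then f s else g s).
Proof.
move=> Hb Hf Hg; apply: (@pr_ext (fun s => b s * f s + (~~ b s) * g s)).
  exact: pr_add (pr_mul Hb Hf) (pr_mul (pr_not Hb) Hg).
by move=> s; case: (b s) => /=; rewrite ?mul1n ?mul0n ?addn0.
Qed.

Lemma pr_sum n (F : (nat -> nat) -> nat -> nat) :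
  PR n -> PR (fun s => F (fun i => s i.+1) (s 0)) -> PR (fun s => \sum_(i < n s) F s i).
Proof.
move=> Hn HF; apply: (@pr_ext (fun s => iteri (n s) (fun i a => a + F s i) 0)).
  apply: (@pr_iteri _ _ (fun s i a => a + F s i)) => //; first exact: pr_const.
  apply: pr_add; first exact: pr_var.
  exact: (pr_ren (fun i => if i is j.+1 then j.+2 else 0) HF).
by move=> s; elim: (n s) => [|m IH]; rewrite ?big_ord0 //= big_ord_recr /= IH.
Qed.

Definition ball n (p : nat -> bool) := all p (iota 0 n).
Definition bex n (p : nat -> bool) := has p (iota 0 n).

Lemma ballP n (p : nat -> bool) : reflect (forall i, i < n -> p i) (ball n p).
Proof.
apply: (iffP allP) => H i; first by move=> Hi; apply: H; rewrite mem_iota.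
by rewrite mem_iota => /= Hi; apply: H.
Qed.

Lemma bexP n (p : nat -> bool) : reflect (exists2 i, i < n & p i) (bex n p).
Proof.
apply: (iffP hasP) => -[i]; rewrite ?mem_iota => Hi Hp; exists i => //.
by rewrite mem_iota.
Qed.

Lemma pr_ball n (p : (nat -> nat) -> nat -> bool) :
  PR n -> PR (fun s => p (fun i => s i.+1) (s 0)) -> PR (fun s => ball (n s) (p s)).
Proof.
move=> Hn Hp; apply: (@pr_ext (fun s => \sum_(i < n s) ~~ p s i == 0)).
  apply: pr_eqn (pr_const _); apply: (@pr_sum _ (fun s i => ~~ p s i)) => //.
  exact: pr_not.
move=> s /=; congr nat_of_bool; rewrite sum_nat_eq0; apply/forallP/ballP => H i.
  by move=> Hi; have := H (Ordinal Hi); rewrite /= eqb0 negbK.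
by rewrite /= eqb0 negbK; apply: H.
Qed.

Lemma pr_bex n (p : (nat -> nat) -> nat -> bool) :
  PR n -> PR (fun s => p (fun i => s i.+1) (s 0)) -> PR (fun s => bex (n s) (p s)).
Proof.
move=> Hn Hp; apply: (@pr_ext (fun s => ~~ ball (n s) (fun i => ~~ p s i))).
  by apply: pr_not; apply: (@pr_ball _ (fun s i => ~~ p s i)) => //; apply: pr_not.
move=> s /=; congr nat_of_bool; rewrite /ball /bex -has_predC; apply: eq_has => i /=.
by rewrite negbK.
Qed.

Lemma sum_ltn b q : \sum_(i < b) (i < q) = minn b q.
Proof.
elim: b => [|b IH]; first by rewrite big_ord0 min0n.
rewrite big_ord_recr /= IH; lia.
Qed.

(** A value bounded by [b] is the number of [i < b] lying below it, so deciding [i < f] is enough.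
    Division and logarithms are obtained in this way. *)
Lemma pr_bounded f b : (forall s, f s <= b s) -> PR b ->
  PR (fun s => s 0 < f (fun i => s i.+1)) -> PR f.
Proof.
move=> Hle Hb Hf; apply: (@pr_ext (fun s => \sum_(i < b s) (i < f s))).
  exact: (@pr_sum _ (fun s i => (i < f s) : nat)).
by move=> s; rewrite sum_ltn; have := Hle s; lia.
Qed.

Lemma pr_div f g : PR f -> PR g -> PR (fun s => f s %/ g s).
Proof.
move=> Hf Hg; apply: (pr_bounded (b := f)) => // [s|]; first exact: leq_div.
apply: (@pr_ext (fun s => (0 < g (fun i => s i.+1)) && ((s 0).+1 * g (fun i => s i.+1) <= f (fun i => s i.+1)))).
  apply: pr_and; first exact: pr_leq (pr_const _) (pr_ren S Hg).
  exact: pr_leq (pr_mul (pr_succ (pr_var _)) (pr_ren S Hg)) (pr_ren S Hf).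
move=> s; case: posnP => [->|H]; first by rewrite divn0.
by rewrite /= leq_divRL.
Qed.

Lemma pr_mod f g : PR f -> PR g -> PR (fun s => f s %% g s).
Proof.
move=> Hf Hg; apply: (@pr_ext (fun s => f s - f s %/ g s * g s)).
  exact: pr_sub Hf (pr_mul (pr_div Hf Hg) Hg).
by move=> s /=; rewrite {1}(divn_eq (f s) (g s)) addKn.
Qed.

Lemma pr_odd f : PR f -> PR (fun s => odd (f s)).
Proof.
move=> Hf; apply: (@pr_ext (fun s => f s %% 2)); last by move=> s; rewrite modn2.
exact: pr_mod (pr_const _).
Qed.

(** * A pairing function and automation *)

Definition pair a b := (a + b) ^ 2 + a.
(** The integer square root of [p]. *)
Definition psum p := \sum_(i < p) (i.+1 ^ 2 <= p).
Definition pi1 p := p - psum p ^ 2.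
Definition pi2 p := psum p - pi1 p.

(** As [a <= a + b], the pair lies strictly below the next square after [(a + b) ^ 2]. *)
Lemma psum_pair a b : psum (pair a b) = a + b.
Proof.
have H i : i < pair a b -> (i.+1 ^ 2 <= pair a b) = (i < a + b).
  by rewrite /pair => _; apply/idP/idP; nia.
rewrite /psum (eq_bigr (fun i : 'I__ => (i < a + b) : nat)).
  by rewrite sum_ltn /pair; nia.
by move=> i _; rewrite H.
Qed.

Lemma pi1_pair a b : pi1 (pair a b) = a.
Proof. by rewrite /pi1 psum_pair /pair addKn. Qed.

Lemma pi2_pair a b : pi2 (pair a b) = b.
Proof. by rewrite /pi2 pi1_pair psum_pair addKn. Qed.

Lemma pr_pair f g : PR f -> PR g -> PR (fun s => pair (f s) (g s)).
Proof. move=> Hf Hg; exact: pr_add (pr_exp (pr_add Hf Hg) (pr_const 2)) Hf. Qed.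

Lemma pr_psum f : PR f -> PR (fun s => psum (f s)).
Proof.
move=> Hf; apply: (pr_comp1 (G := psum)) Hf.
apply: (@pr_sum _ (fun s i => (i.+1 ^ 2 <= s 0) : nat)); first exact: pr_var.
exact: pr_leq (pr_exp (pr_succ (pr_var _)) (pr_const 2)) (pr_var 1).
Qed.

Lemma pr_pi1 f : PR f -> PR (fun s => pi1 (f s)).
Proof. move=> Hf; exact: pr_sub Hf (pr_exp (pr_psum Hf) (pr_const 2)). Qed.

Lemma pr_pi2 f : PR f -> PR (fun s => pi2 (f s)).
Proof. move=> Hf; exact: pr_sub (pr_psum Hf) (pr_pi1 Hf). Qed.

(** A hook, redefined once further closure lemmas are available. *)
Ltac pr_extra := fail.
Ltac pr := repeat lazymatch goal with
 | |- PR (fun s => s _) => apply: pr_var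
 | |- PR (fun _ => ?n) => apply: pr_const
 | |- PR (fun s => (@?f s).+1) => apply: pr_succ
 | |- PR (fun s => (@?f s).-1) => apply: pr_pred
 | |- PR (fun s => pair (@?f s) (@?g s)) => apply: pr_pair
 | |- PR (fun s => pi1 (@?f s)) => apply: pr_pi1
 | |- PR (fun s => pi2 (@?f s)) => apply: pr_pi2
 | |- PR (fun s => @?f s ^ @?g s) => apply: pr_exp
 | |- PR (fun s => @?f s + @?g s) => apply: pr_add
 | |- PR (fun s => @?f s - @?g s) => apply: pr_sub
 | |- PR (fun s => @?f s * @?g s) => apply: pr_mul
 | |- PR (fun s => @?f s %/ @?g s) => apply: pr_div
 | |- PR (fun s => @?f s %% @?g s) => apply: pr_mod
 | |- PR (fun s => nat_of_bool (odd (@?f s))) => apply: pr_odd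
 | |- PR (fun s => nat_of_bool (@?f s <= @?g s)) => apply: pr_leq
 | |- PR (fun s => nat_of_bool (@?f s == @?g s)) => apply: pr_eqn
 | |- PR (fun s => nat_of_bool (~~ @?f s)) => apply: pr_not
 | |- PR (fun s => nat_of_bool (@?f s && @?g s)) => apply: pr_and
 | |- PR (fun s => nat_of_bool (@?f s ==> @?g s)) => apply: pr_imp
 | |- PR (fun s => nat_of_bool (@?b s)) => first [assumption | pr_extra]
 | |- _ => first [assumption | pr_extra | apply: pr_if]
 end.

Lemma pr_trunc_log2 f : PR f -> PR (fun s => trunc_log 2 (f s)).
Proof.
move=> Hf; apply: (pr_comp1 (G := trunc_log 2)) Hf.
apply: (pr_bounded (b := fun s => s 0)) => [s||]; [|by pr|].
  case: (posnP (s 0)) => [->|H]; first by rewrite trunc_log0.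
  by apply: leq_trans (trunc_logP (isT : 1 < 2) H); apply: ltnW (ltn_expl _ _).
apply: (@pr_ext (fun s => (2 ^ (s 0).+1 <= s 1))); first by pr.
move=> s /=; congr nat_of_bool; apply/idP/idP => H.
  exact: trunc_log_max.
case: (posnP (s 1)) H => [->|H1 H]; first by rewrite trunc_log0.
apply: leq_trans (trunc_logP (isT : 1 < 2) H1); exact: leq_pexp2l.
Qed.

Lemma pr_logn2 f : PR f -> PR (fun s => logn 2 (f s)).
Proof.
move=> Hf; apply: (pr_comp1 (G := logn 2)) Hf.
apply: (pr_bounded (b := fun s => s 0)) => [s||]; [|by pr|].
  case: (posnP (s 0)) => [->|H]; first by rewrite logn0.
  exact/ltnW/ltn_logl.
apply: (@pr_ext (fun s => (0 < s 1) && (s 1 %% 2 ^ (s 0).+1 == 0))); first by pr.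
move=> s /=; congr nat_of_bool; case: posnP => [->|H]; first by rewrite logn0.
by rewrite -/(dvdn _ _) pfactor_dvdn.
Qed.

(** * A normal form for computations *)

(* The first bit of [s] is the least significant one, and a leading 1 marks the length. *)
Fixpoint enc (s : seq bool) := if s is b :: s' then b + (enc s').*2 else 1.

Lemma enc_gt0 s : 0 < enc s.
Proof. elim: s => //= b s; lia. Qed.

(** Loads counter 1 into the address register. The register admits only reset and appending a low
    bit, so the bits are pushed from the most significant one. Counter 2 holds the position of the
    bit and counter 3 the bit. *)
Definition frag_set_addr k eBit := frag_seq (frag_reg RReset) (frag_seq (copy k 1 2 3)
  (frag_while (test_reg k 2) (frag_seq (dec k 2) (frag_seq (compile k eBit 3)
    (frag_if (test_reg k 3) (frag_seq (dec k 3) (frag_reg (RPush true)))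
       (frag_reg (RPush false))))))).

Ltac cases4 := let i := fresh in
  move=> i _; case: i => [|[|[|[|i]]]]; rewrite /upd /= ?nth_nil ?addn0 ?add0n //.

Lemma cmd_set_addr k eBit x o r N j : 3 + height eBit <= k ->
  (forall s, eval eBit s = odd (s 1 %/ 2 ^ s 0)) ->
  cmd (frag_set_addr k eBit) x (st k (nth 0 [:: N; j]) o r) (st k (nth 0 [:: N; j]) o j).
Proof.
move=> Hk He; have Hh := height_gt0 eBit.
have [k1 k2 k3] : [/\ 1 < k, 2 < k & 3 < k] by split; lia.
apply: cmd_seq (cmd_reg RReset _ _ _) _.
have HC := @cmd_copy k 1 2 3 x (nth 0 [:: N; j]) o 0 k1 k2 k3.
apply: cmd_seq (HC _ _ _ _) _ => // {HC}.
rewrite (@st_ext k (upd _ _ _) (nth 0 [:: N; j; j])); last by cases4.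
(* Invariant: with [u] bits still to push, the register holds [j] without its [u] low bits. The
   start [u = j] is large enough since [j < 2 ^ j]. *)
suff H u q : q = j %/ 2 ^ u -> cmd (frag_while (test_reg k 2) (frag_seq (dec k 2) (frag_seq (compile k eBit 3)
    (frag_if (test_reg k 3) (frag_seq (dec k 3) (frag_reg (RPush true)))
       (frag_reg (RPush false)))))) x (st k (nth 0 [:: N; j; u]) o q) (st k (nth 0 [:: N; j]) o j).
  by apply: H; rewrite divn_small // ltn_expl.
elim: u q => [|u IH] q Eq.
  rewrite Eq divn1 (@st_ext k (nth 0 [:: N; j]) (nth 0 [:: N; j; 0])); last by cases4.
  exact: cmd_while_false (@does_test_reg k 2 x (nth 0 [:: N; j; 0]) o j k2).
apply: cmd_while_true (@does_test_reg k 2 x (nth 0 [:: N; j; u.+1]) o q k2) _ (IH _ (erefl _)).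
apply: cmd_seq (cmd_dec _ _ _ k2 (erefl _)) _.
rewrite (@st_ext k (upd _ _ _) (nth 0 [:: N; j; u])); last by cases4.
apply: cmd_seq (cmd_compile _ _ _ Hk _) _.
  by move=> i Hi; rewrite nth_default //=; lia.
rewrite He.
set b := odd _; have Eb : b = odd (j %/ 2 ^ u) by [].
have -> : j %/ 2 ^ u = q.*2 + b.
  by rewrite Eb {1}(divn_eq (j %/ 2 ^ u) 2) -divnMA -expnSr -Eq muln2 modn2.
set g := upd _ 3 _.
have Eg : g 3 = b by [].
apply: cmd_if (@does_test_reg k 3 x g o q k3) _.
rewrite Eg; case: (b) Eg => /= Eg.
  apply: cmd_seq (cmd_dec _ _ _ k3 Eg) _.
  rewrite (@st_ext k (upd _ _ _) (nth 0 [:: N; j; u])); last by rewrite /g; cases4.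
  exact: cmd_reg.
rewrite (@st_ext k g (nth 0 [:: N; j; u])); last first.
  by rewrite /g; cases4.
exact: cmd_reg.
Qed.

Definition has_input := frag_test (fun _ c => c != None).
Definition input1 := frag_test (fun _ c => c == Some true).

(** Counter 1 is the position; counter 0 encodes the prefix read so far, reversed because each new
    bit enters as the least significant one. The loop stops at the first address out of range. *)
Definition frag_read k eBit e0 e1 := frag_while (frag_seq (frag_set_addr k eBit) has_input)
  (frag_seq (frag_if input1 (compile k e1 2) (compile k e0 2))
  (frag_seq (clear k 0) (frag_seq (mv k 2 0) (inc k 1)))).

Lemma cmd_read k eBit e0 e1 x o : 3 + height eBit <= k ->
  2 + height e0 <= k -> 2 + height e1 <= k ->
  (forall s, eval eBit s = odd (s 1 %/ 2 ^ s 0)) ->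
  (forall s, eval e0 s = s 1 + s 1) -> (forall s, eval e1 s = (s 1 + s 1).+1) ->
  exists r', cmd (frag_read k eBit e0 e1) x (st k (nth 0 [:: 1; 0]) o 0)
       (st k (nth 0 [:: enc (rev x); size x]) o r').
Proof.
move=> Hk Hk0 Hk1 HB H0 H1; exists (size x).
have Hh := height_gt0 eBit.
have [k0 k1 k2] : [/\ 0 < k, 1 < k & 2 < k] by split; lia.
suff H n j r : size x = n + j -> cmd (frag_read k eBit e0 e1) x
   (st k (nth 0 [:: enc (rev (take j x)); j]) o r) (st k (nth 0 [:: enc (rev x); size x]) o (size x)).
  by have := H (size x) 0 0; rewrite take0; apply; rewrite addn0.
elim: n j r => [|n IH] j r Ej.
  have -> : j = size x by lia.
  rewrite take_size; apply: cmd_while_false.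
  apply: does_seq (cmd_set_addr _ _ _ _ _ Hk HB) _.
  by have := @does_test (fun _ c => c != None) x (st k (nth 0 [:: enc (rev x); size x]) o 0).1 (size x);
    rewrite /read_at ltnn.
have Hj : j < size x by lia.
apply: (@cmd_while_true _ _ _ _ (st k (nth 0 [:: enc (rev (take j x)); j]) o j) _ _ _ _ (IH j.+1 j _)); last lia.
  apply: does_seq (cmd_set_addr _ _ _ _ _ Hk HB) _.
  by have := @does_test (fun _ c => c != None) x (st k (nth 0 [:: enc (rev (take j x)); j]) o 0).1 j;
    rewrite /read_at Hj.
set N := enc (rev (take j x)).
have HN : enc (rev (take j.+1 x)) = nth false x j + N.*2.
  by rewrite (take_nth false Hj) rev_rcons.
have Hc : cmd (frag_if input1 (compile k e1 2) (compile k e0 2)) x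
   (st k (nth 0 [:: N; j]) o j) (st k (nth 0 [:: N; j; enc (rev (take j.+1 x))]) o j).
  have Hz i : 1 < i < k -> nth 0 [:: N; j] i = 0.
    by move=> Hi; rewrite nth_default //=; lia.
  apply: cmd_if.
    exact: (@does_test (fun _ c => c == Some true) x (st k (nth 0 [:: N; j]) o 0).1 j).
  rewrite /read_at Hj HN; case: (nth false x j) => /=.
    apply: cmd_st_eq (cmd_compile _ _ _ Hk1 Hz) _.
    by rewrite H1 addnn; cases4.
  apply: cmd_st_eq (cmd_compile _ _ _ Hk0 Hz) _.
  by rewrite H0 addnn; cases4.
apply: cmd_seq Hc (cmd_seq (cmd_clear _ _ _ _ k0) (cmd_seq (cmd_mv _ _ _ _ k2 k0 _) _)) => //.
apply: cmd_st_eq (cmd_inc _ _ _ _ k1) _.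
by cases4.
Qed.

(** Unbounded search: counter 1 grows until the value of [e] is 0. Hence the search condition is
    compiled in negated form. *)
Definition frag_mu k e := frag_while (frag_seq (compile k e 2) (frag_if (test_reg k 2)
    (frag_seq (clear k 2) (frag_const true)) (frag_const false))) (inc k 1).

Definition env2 a b := scons a (scons b (fun _ => 0)).

Lemma env_nth2 N s : env (nth 0 [:: N; s]) 2 = env2 s N.
Proof. by apply: functional_extensionality => -[|[|i]]. Qed.

Lemma cmd_mu k e x o r N s0 : 2 + height e <= k -> eval e (env2 s0 N) = 0 ->
  (forall s, s < s0 -> eval e (env2 s N) != 0) ->
  cmd (frag_mu k e) x (st k (nth 0 [:: N; 0]) o r) (st k (nth 0 [:: N; s0]) o r).
Proof.
move=> Hk H0 Hmin; have Hh := height_gt0 e.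
have [k1 k2] : 1 < k /\ 2 < k by split; lia.
suff H n s : s0 = n + s ->
  cmd (frag_mu k e) x (st k (nth 0 [:: N; s]) o r) (st k (nth 0 [:: N; s0]) o r).
  by apply: (H s0); rewrite addn0.
have HT t : does (frag_seq (compile k e 2) (frag_if (test_reg k 2)
    (frag_seq (clear k 2) (frag_const true)) (frag_const false))) x
    (st k (nth 0 [:: N; t]) o r) (eval e (env2 t N) != 0) (st k (nth 0 [:: N; t]) o r).
  have Hz i : 1 < i < k -> nth 0 [:: N; t] i = 0.
    by move=> Hi; rewrite nth_default //=; lia.
  apply: does_seq (cmd_compile _ _ _ Hk Hz) _; rewrite env_nth2.
  set v := eval _ _; set g := upd _ 2 v.
  apply: does_if (@does_test_reg k 2 x g o r k2) _.
  have -> : g 2 = v by []; case: eqVneq => /= [v0|_].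
    rewrite (@st_ext k g (nth 0 [:: N; t])); last by rewrite /g v0; cases4.
    exact: does_const.
  apply: does_seq (cmd_clear _ _ _ _ k2) _.
  rewrite (@st_ext k (upd _ _ _) (nth 0 [:: N; t])); last by rewrite /g; cases4.
  exact: does_const.
elim: n s => [|n IH] s Es.
  rewrite add0n in Es; rewrite -Es.
  by apply: cmd_while_false; have := HT s0; rewrite H0.
have := HT s; rewrite (Hmin s) => [H|]; last lia.
apply: cmd_while_true H _ (IH s.+1 _); last lia.
apply: cmd_st_eq (cmd_inc _ _ _ _ k1) _.
by cases4.
Qed.

(** The counters rotate behind the output block, whose bits are then copied; the new bit follows
    them before the terminating 0 is renewed. *)
Definition emit k b := frag_seq (rots k) (frag_seq copy_pairs
  (frag_seq (push true) (frag_seq (push b) (frag_seq pop (push false))))).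

Lemma cmd_emit k b x f o r : cmd (emit k b) x (st k f o r) (st k f (rcons o b) r).
Proof.
have := cmd_rots x (mkseq f k) (outs o) r; rewrite {1}size_mkseq => H1.
apply: cmd_seq H1 _.
have := cmd_copy_pairs x o (flat (mkseq f k)) r; rewrite -cat_rcons => H2.
apply: cmd_seq H2 _.
apply: cmd_seq (cmd_push _ _ _ _) _; apply: cmd_seq (cmd_push _ _ _ _) _.
apply: cmd_seq; first exact: cmd_pop.
have := cmd_push false x (rcons (rcons (flat (mkseq f k) ++ pairs o) true) b) r.
have -> // : rcons (rcons (rcons (flat (mkseq f k) ++ pairs o) true) b) false =
  flat (mkseq f k) ++ outs (rcons o b).
by rewrite /outs /pairs map_rcons flatten_rcons -!cats1 -!catA.
Qed.

(** Counter 2 holds [(enc y).-1], which is 0 exactly when no bits are left. Otherwise its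
    predecessor has the next bit as parity, and halving it gives the same quantity for the tail. *)
Definition frag_emit k eOdd eHalf := frag_while (test_reg k 2)
  (frag_seq (compile k eOdd 3)
  (frag_seq (frag_if (test_reg k 3) (frag_seq (dec k 3) (emit k true)) (emit k false))
  (frag_seq (compile k eHalf 3) (frag_seq (clear k 2) (mv k 3 2))))).

Lemma cmd_frag_emit k eOdd eHalf x r N s y : 3 + height eOdd <= k -> 3 + height eHalf <= k ->
  (forall s, eval eOdd s = odd (s 0).-1) -> (forall s, eval eHalf s = (s 0).-1 %/ 2) ->
  exists f, cmd (frag_emit k eOdd eHalf) x (st k (nth 0 [:: N; s; (enc y).-1]) [::] r) (st k f y r).
Proof.
move=> Hk1 Hk2 HO HH; have Hh := height_gt0 eOdd.
have [k2 k3] : 2 < k /\ 3 < k by split; lia.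
exists (nth 0 [:: N; s; 0]).
suff H o : cmd (frag_emit k eOdd eHalf) x (st k (nth 0 [:: N; s; (enc y).-1]) o r)
   (st k (nth 0 [:: N; s; 0]) (o ++ y) r) by apply: (H [::]).
elim: y o => [|b y IH] o.
  rewrite cats0; apply: cmd_while_false (@does_test_reg k 2 x (nth 0 [:: N; s; 0]) o r k2).
set c := (enc (b :: y)).-1.
have Hc : c = (b + ((enc y).-1).*2).+1 by have := enc_gt0 y; rewrite /c /=; lia.
rewrite -cat_rcons.
have Hz d i : 2 < i < k -> nth 0 [:: N; s; d] i = 0.
  by move=> Hi; rewrite nth_default //=; lia.
apply: (@cmd_while_true _ _ _ _ (st k (nth 0 [:: N; s; c]) o r) _ _ _ _ (IH _)).
  by have := @does_test_reg k 2 x (nth 0 [:: N; s; c]) o r k2; have -> : nth 0 [:: N; s; c] 2 != 0 by rewrite /= Hc.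
apply: cmd_seq (cmd_compile _ _ _ Hk1 (@Hz c)) _.
rewrite HO; set g := upd _ 3 _.
have Eg : g 3 = b.
  rewrite /g /upd eqxx; change (odd c.-1 = b :> nat); rewrite Hc /= oddD odd_double addbF.
  by case: (b).
have Eg' : forall i, i < k -> i != 3 -> g i = nth 0 [:: N; s; c] i.
  by move=> i _ Hi; rewrite /g /upd (negPf Hi).
apply: (@cmd_seq _ _ _ _ (st k (nth 0 [:: N; s; c]) (rcons o b) r)).
  apply: cmd_if (@does_test_reg k 3 x g o r k3) _.
  rewrite Eg; case: (b) Eg => /= Eg.
    apply: cmd_seq (cmd_dec _ _ _ k3 Eg) _.
    rewrite (@st_ext k (upd _ _ _) (nth 0 [:: N; s; c])); first exact: cmd_emit.
    by rewrite /g; cases4.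
  rewrite (@st_ext k g (nth 0 [:: N; s; c])); first exact: cmd_emit.
  move=> i Hi; case: (eqVneq i 3) => [->|]; [by rewrite Eg|exact: Eg'].
apply: cmd_seq (cmd_compile _ _ _ Hk2 (@Hz c)) _.
rewrite HH; set h := upd _ 3 _.
have Eh : h 3 = (enc y).-1.
  rewrite /h /upd eqxx; change (c.-1 %/ 2 = (enc y).-1); rewrite Hc /=.
  by rewrite divn2 halfD odd_double andbF doubleK; case: (b).
apply: cmd_seq (cmd_clear _ _ _ _ k2) _.
apply: cmd_st_eq (cmd_mv _ _ _ _ k3 k2 _) _ => //.
move=> i _; case: i => [|[|[|[|i]]]] //; rewrite /upd /= ?nth_nil //.
Qed.

Definition frag_finish k := frag_seq (frag_iter k (frag_seq (frag_while is1 pop) pop))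
  (frag_seq (frag_while is1 (frag_seq pop copy_bit)) pop).

Lemma cmd_finish k x f o r : cmd (frag_finish k) x (st k f o r) (o, r).
Proof.
apply: (@cmd_seq _ _ _ _ (outs o, r)).
  rewrite /st; have := size_mkseq f k; move: (mkseq f k) => s <-.
  elim: s => [|a s IH] /=; first by exists true; apply: does_const.
  apply: cmd_seq _ IH; rewrite flat_cons -catA /seg cat_rcons.
  apply: cmd_seq _ (cmd_pop _ _ _ _).
  elim: a => [|a IH]; first exact: cmd_while_false (does_is1_false _ _ _).
  exact: cmd_while_true (does_is1_true _ _ _) (cmd_pop _ _ _ _) IH.
apply: cmd_seq _ (cmd_pop _ _ _ _).
rewrite /outs -cats1 -[o in X in cmd _ _ _ X]cat0s.
elim: o [::] => [|b o IH] w /=.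
  rewrite cats0; exact: cmd_while_false (does_is1_false _ _ _).
apply: cmd_while_true (does_is1_true _ _ _) (cmd_seq (cmd_pop _ _ _ _) (cmd_copy_bit _ _ _ _)) _.
by have := IH (rcons w b); rewrite cat_rcons -rcons_cons -rcons_cat.
Qed.

(** The machine reads its input into a number, searches for the least [s] satisfying [B], and prints
    the string encoded by [C]. The input appears reversed because of the way [frag_read] builds the
    number. *)
Theorem kleene_normal_form (B : nat -> nat -> bool) (C : nat -> nat -> nat) :
  PR (fun s => B (s 0) (s 1)) -> PR (fun s => C (s 0) (s 1)) ->
  exists M : TM, forall p s y,
    B s (enc (rev p)) -> (forall s', s' < s -> ~~ B s' (enc (rev p))) ->
    C s (enc (rev p)) = enc y -> outputs M p y.
Proof.
move=> /pr_not [eB HB] /pr_pred [eC HC].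
have [eBit HBit] : PR (fun s => odd (s 1 %/ 2 ^ s 0)) by pr.
have [e0 H0] : PR (fun s => s 1 + s 1) by pr.
have [e1 H1] : PR (fun s => (s 1 + s 1).+1) by pr.
have [eOdd HO] : PR (fun s => odd (s 0).-1) by pr.
have [eHalf HH] : PR (fun s => (s 0).-1 %/ 2) by pr.
pose k := 3 + height eB + height eC + height eBit + height e0 + height e1
  + height eOdd + height eHalf.
have [k0 k1] : 0 < k /\ 1 < k by rewrite /k; split; lia.
pose F := frag_seq (frag_iter k.+1 (push false)) (frag_seq (inc k 0)
  (frag_seq (frag_read k eBit e0 e1) (frag_seq (clear k 1)
  (frag_seq (frag_mu k eB) (frag_seq (compile k eC 2)
  (frag_seq (frag_emit k eOdd eHalf) (frag_finish k))))))).
exists (frag_TM F) => p s y; set N := enc (rev p) => HBs Hmin Hy.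
have Hinit : cmd (frag_iter k.+1 (push false)) p ([::], 0) (st k (fun _ => 0) [::] 0).
  (* Each zero counter is a single 0, and so is the empty output: [k.+1] zeros in all. *)
  have -> : st k (fun _ => 0) [::] 0 = (nseq k.+1 false, 0).
    have -> : nseq k.+1 false = nseq k false ++ [:: false] by rewrite cats1; elim: (k) => //= n ->.
    rewrite /st /mkseq; congr (_ ++ _, _).
    rewrite -[in RHS](size_iota 0 k); elim: (iota 0 k) => //= i l IH.
    by rewrite flat_cons IH.
  apply: (cmd_iter (S := fun i => (nseq i false, 0))) => i _.
  have -> : nseq i.+1 false = rcons (nseq i false) false by elim: i => //= i ->.
  exact: cmd_push.
have [r Hread] := @cmd_read k eBit e0 e1 p [::] ltac:(rewrite /k; lia)
  ltac:(rewrite /k; lia) ltac:(rewrite /k; lia) HBit H0 H1.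
have Hmu : cmd (frag_mu k eB) p (st k (nth 0 [:: N; 0]) [::] r) (st k (nth 0 [:: N; s]) [::] r).
  apply: cmd_mu; first by rewrite /k; lia.
    by rewrite HB /= HBs.
  by move=> s' /Hmin; rewrite HB /=; case: (B s' N).
have [||f Hemit] := @cmd_frag_emit k eOdd eHalf p r N s y _ _ HO HH; try by rewrite /k; lia.
have [b [HF]] : cmd F p ([::], 0) (y, r).
  apply: cmd_seq Hinit _; apply: cmd_seq (cmd_inc _ _ _ _ k0) _.
  rewrite (@st_ext k (upd _ _ _) (nth 0 [:: 1; 0])); last by cases4.
  apply: cmd_seq Hread _; apply: cmd_seq (cmd_clear _ _ _ _ k1) _.
  rewrite (@st_ext k (upd _ _ _) (nth 0 [:: N; 0])); last by cases4.
  apply: cmd_seq Hmu _; apply: cmd_seq (cmd_compile _ _ _ _ _) _.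
  - by rewrite /k; lia.
  - by move=> i Hi; rewrite nth_default //=; lia.
  rewrite env_nth2 HC /= Hy (@st_ext k (upd _ _ _) (nth 0 [:: N; s; (enc y).-1])); last by cases4.
  apply: cmd_seq Hemit _; exact: cmd_finish.
have [|tp Hex [a [z [_ Htp]]]] := HF blank_tape; first by exists 0, 1.
have [n Hn] := steps_run Hex; exists n, b, tp; split; first exact: Hn.
rewrite Htp; elim: (y) => [|c w IH] /=; first by case: z {Htp}.
by rewrite IH.
Qed.

Lemma enc_inj : injective enc.
Proof.
elim=> [|b s IH] [|b' s'] //=.
- by have := enc_gt0 s'; lia.
- by have := enc_gt0 s; lia.
move=> E; have [Eb Es] : b = b' /\ enc s = enc s'.
  by case: b b' E => -[] /=; split=> //; lia.
by rewrite Eb (IH _ Es).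
Qed.

Lemma enc_size s : 2 ^ size s <= enc s < 2 ^ (size s).+1.
Proof. elim: s => //= b s; rewrite !expnS; lia. Qed.

(** * An arithmetic interpreter *)

Definition csym (a : option bool) := if a is Some b then b.+1 else 0.
Definition dsym n := match n with 0 => None | 1 => Some false | _ => Some true end.
Definition cmove m := match m with MoveL => 0 | MoveR => 1 | Stay => 2 end.
Definition creg o := match o with RKeep => 0 | RReset => 1 | RPush b => b.+2 end.
(** A half tape is a base-3 number with the cell next to the head as lowest digit; blanks are the
    digit 0, so the unwritten part needs no care. *)
Definition ctp := foldr (fun a n => csym a + 3 * n) 0.

Lemma csymK : cancel csym dsym.
Proof. by case=> [[]|]. Qed.

Lemma csym_lt a : csym a < 3.
Proof. by case: a => [[]|]. Qed.

(** Because of the leading 1 in the encoding, [2 ^ i.+1 <= X] says that position [i] is in range. *)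
Definition rd X i := if 2 ^ i.+1 <= X then (odd (X %/ 2 ^ i)).+1 else 0.

Lemma rd_enc x i : rd (enc x) i = csym (read_at x i).
Proof.
rewrite /rd /read_at.
have -> : (2 ^ i.+1 <= enc x) = (i < size x).
  have /andP[H1 H2] := enc_size x; apply/idP/idP => H.
    by have := leq_ltn_trans H H2; rewrite ltn_exp2l.
  by apply: leq_trans H1; rewrite leq_exp2l.
case: ltnP => //= ; elim: x i => [|b x IH] [|i] //= H.
  by rewrite divn1 oddD odd_double addbF; case: b.
rewrite expnS divnMA divn2 halfD odd_double andbF doubleK.
by rewrite (_ : b./2 = 0) ?add0n ?IH //; case: b.
Qed.

Definition nthp D i := pi1 (iter i pi2 D).

Lemma nthp_foldr s i : i < size s -> nthp (foldr pair 0 s) i = nth 0 s i.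
Proof.
rewrite /nthp; elim: s i => [|a s IH] [|i] //= H; first by rewrite pi1_pair.
by rewrite -iterS iterSr pi2_pair IH.
Qed.

Lemma pr_nthp f g : PR f -> PR g -> PR (fun s => nthp (f s) (g s)).
Proof.
move=> Hf Hg; apply: pr_pi1; apply: (@pr_iter _ _ (fun _ => pi2)) => //; pr.
Qed.

Lemma pr_rd f g : PR f -> PR g -> PR (fun s => rd (f s) (g s)).
Proof. by move=> Hf Hg; rewrite /rd; pr. Qed.

Ltac pr_extra ::= lazymatch goal with
 | |- PR (fun s => nthp (@?f s) (@?g s)) => apply: pr_nthp
 | |- PR (fun s => rd (@?f s) (@?g s)) => apply: pr_rd
 end.

(* A configuration is the tuple (status, state, left, head, right, r1, r2), with
   status 0 while running and b.+1 after halting with answer b. *)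
Definition c_q c := pi1 (pi2 c).
Definition c_l c := pi1 (pi2 (pi2 c)).
Definition c_h c := pi1 (pi2 (pi2 (pi2 c))).
Definition c_r c := pi1 (pi2 (pi2 (pi2 (pi2 c)))).
Definition c_1 c := pi1 (pi2 (pi2 (pi2 (pi2 (pi2 c))))).
Definition c_2 c := pi2 (pi2 (pi2 (pi2 (pi2 (pi2 c))))).

Definition nregop o r := if o == 0 then r else if o == 1 then 0 else r + r + (o - 2).

Definition nmove c q w m o1 o2 :=
  pair 0 (pair q (pair
   (if m == 0 then c_l c %/ 3 else if m == 1 then w + 3 * c_l c else c_l c) (pair
   (if m == 0 then c_l c %% 3 else if m == 1 then c_r c %% 3 else w) (pair
   (if m == 0 then w + 3 * c_r c else if m == 1 then c_r c %/ 3 else c_r c) (pair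
   (nregop o1 (c_1 c)) (nregop o2 (c_2 c))))))).

Definition nexec c e :=
  if pi1 e == 0 then pair (pi2 e).+1 (pi2 c) else
  nmove c (pi1 (pi2 e)) (pi1 (pi2 (pi2 e))) (pi1 (pi2 (pi2 (pi2 e))))
    (pi1 (pi2 (pi2 (pi2 (pi2 e))))) (pi2 (pi2 (pi2 (pi2 (pi2 e))))).

Definition nstep D X V c := if pi1 c == 0 then
  nexec c (nthp (pi2 D) (27 * c_q c + 9 * c_h c + 3 * rd X (c_1 c) + rd V (c_2 c))) else c.

Definition nsim D X V n :=
  pi1 (iter n (nstep D X V) (pair 0 (pair (pi1 D) (pair 0 (pair 0 (pair 0 (pair 0 0))))))).

Lemma pr_nsim f g h k : PR f -> PR g -> PR h -> PR k ->
  PR (fun s => nsim (f s) (g s) (h s) (k s)).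
Proof.
apply: (pr_comp4 (G := nsim)); rewrite /nsim; apply: pr_pi1.
apply: (@pr_iter _ _ (fun s => nstep (s 0) (s 1) (s 2))); [by pr|by pr|].
rewrite /nstep; apply: pr_if; [by pr| |by pr].
apply: (pr_comp2 (G := nexec)); [|by pr|by rewrite /c_q /c_h /c_1 /c_2; pr].
by rewrite /nexec /nmove /nregop /c_l /c_r /c_1 /c_2; pr.
Qed.

Section Code.
Variable M : TM.

Definition centry (e : bool + (tm_state M * option bool * move * regop * regop)) :=
  match e with
  | inl b => pair 0 b
  | inr (q, w, m, o1, o2) => pair 1 (pair (index q (enum (tm_state M)))
      (pair (csym w) (pair (cmove m) (pair (creg o1) (creg o2)))))
  end.

(** There are 27 entries per state, one for each triple of work symbol, input symbol and advice
    symbol. *)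
Definition ctable := mkseq (fun i => centry
   (tm_delta (nth (tm_start M) (enum (tm_state M)) (i %/ 27))
      (dsym (i %/ 9 %% 3)) (dsym (i %/ 3 %% 3)) (dsym (i %% 3))))
   (27 * #|tm_state M|).

Definition code := pair (index (tm_start M) (enum (tm_state M))) (foldr pair 0 ctable).

Lemma ctableP q a b c :
  nthp (pi2 code) (27 * index q (enum (tm_state M)) + 9 * csym a + 3 * csym b + csym c) =
  centry (tm_delta q a b c).
Proof.
have Hq : index q (enum (tm_state M)) < #|tm_state M| by rewrite cardT index_mem mem_enum.
have Ha := csym_lt a; have Hb := csym_lt b; have Hc := csym_lt c.
rewrite /code pi2_pair nthp_foldr; last by rewrite size_mkseq; lia.
rewrite nth_mkseq; last by lia.
set i := _ + csym c.
have -> : i %/ 27 = index q (enum (tm_state M)) by rewrite /i; lia.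
have -> : i %/ 9 %% 3 = csym a by rewrite /i; lia.
have -> : i %/ 3 %% 3 = csym b by rewrite /i; lia.
have -> : i %% 3 = csym c by rewrite /i; lia.
by rewrite !csymK nth_index // mem_enum.
Qed.

Definition ccfg b (c : config M) := pair b (pair (index (cstate c) (enum (tm_state M)))
  (pair (ctp (tleft (ctape c))) (pair (csym (thead (ctape c))) (pair (ctp (tright (ctape c)))
  (pair (creg1 c) (creg2 c)))))).

Lemma nregopE o r : nregop (creg o) r = reg_apply o r.
Proof. by case: o => [|b|] //=; rewrite /nregop /= addnn subn2. Qed.

Lemma iter_halted D X V n c : pi1 c != 0 -> iter n (nstep D X V) c = c.
Proof. by move=> H; elim: n => //= n ->; rewrite /nstep (negPf H). Qed.

Lemma nexec_halt c b : nexec (ccfg 0 c) (centry (inl b)) = ccfg b.+1 c.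
Proof. by rewrite /nexec /ccfg !(pi1_pair, pi2_pair). Qed.

Lemma nexec_move c q w m o1 o2 : nexec (ccfg 0 c) (centry (inr (q, w, m, o1, o2))) =
  ccfg 0 (Cfg q (tape_move m (tape_write (ctape c) w))
    (reg_apply o1 (creg1 c)) (reg_apply o2 (creg2 c))).
Proof.
rewrite /nexec /= !(pi1_pair, pi2_pair) /= /nmove !nregopE /c_l /c_r /c_1 /c_2 /ccfg.
rewrite !(pi1_pair, pi2_pair) /=; have Hw := csym_lt w.
congr (pair _ (pair _ _)); case: (ctape c) => l h r; case: m => /=; last by [].
+ case: l => [|b l] /=; first by rewrite div0n.
  have Hb := csym_lt b; congr (pair _ (pair _ _)); lia.
+ case: r => [|b r] /=; first by rewrite div0n.
  have Hb := csym_lt b; congr (pair _ (pair _ (pair _ _))); lia.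
Qed.

(** With fuel [n], [run] consults the transition table up to [n.+1] times, as halting costs no fuel;
    the interpreter spends a step on it. *)
Lemma nsim_run x beta n c :
  pi1 (iter n.+1 (nstep code (enc x) (enc beta)) (ccfg 0 c)) =
  if run M x beta n c is Some (acc, _) then acc.+1 else 0.
Proof.
have E c' : nstep code (enc x) (enc beta) (ccfg 0 c') =
   nexec (ccfg 0 c') (centry (tm_delta (cstate c') (thead (ctape c'))
      (read_at x (creg1 c')) (read_at beta (creg2 c')))).
  rewrite /nstep {1}/ccfg pi1_pair /= -ctableP; congr (nexec _ (nthp _ _)).
  by rewrite /c_q /c_h /c_1 /c_2 /ccfg !(pi1_pair, pi2_pair) !rd_enc.
elim: n c => [|n IH] c; rewrite iterSr E [in RHS]/=;
  case: (tm_delta _ _ _ _) => [acc|[[[[q w] m] o1] o2]].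
- by rewrite nexec_halt /= pi1_pair.
- by rewrite nexec_move /= pi1_pair.
- by rewrite nexec_halt iter_halted pi1_pair.
- by rewrite nexec_move IH.
Qed.

Lemma nsimP x beta n : nsim code (enc x) (enc beta) n.+1 =
  if run M x beta n (init_cfg M) is Some (acc, _) then acc.+1 else 0.
Proof. by rewrite -nsim_run /nsim /code pi1_pair. Qed.

Lemma run_mono x beta n m c r : n <= m -> run M x beta n c = Some r -> run M x beta m c = Some r.
Proof.
elim: n m c => [|n IH] [|m] c //= H; case: (tm_delta _ _ _ _) => // -[[[[q w] mv] o1] o2] //.
exact: IH.
Qed.

Lemma run_det x beta n m c r r' : run M x beta n c = Some r -> run M x beta m c = Some r' -> r = r'.
Proof.
move=> H1 H2; have := run_mono (leq_maxl n m) H1.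
by rewrite (run_mono (leq_maxr n m) H2) => -[].
Qed.

Lemma outputs_det p y y' : outputs M p y -> outputs M p y' -> y = y'.
Proof. by move=> [n [a [tp [H1 <-]]]] [n' [a' [tp' [H2 <-]]]]; have [_ ->] := run_det H1 H2. Qed.

Lemma size_out_bits s : size (out_bits s) <= size s.
Proof. by elim: s => [|[b|] s IH]. Qed.

(** A step lengthens the right half by at most one cell. Thus a halting time bounds the length of
    the output. *)
Lemma run_size x beta n c acc tp : run M x beta n c = Some (acc, tp) ->
  size (tright tp) <= size (tright (ctape c)) + n.
Proof.
elim: n c => [|n IH] c /=; case: (tm_delta _ _ _ _) => [a|[[[[q w] m] o1] o2]] //.
- by move=> [_ <-]; rewrite addn0.
- by move=> [_ <-]; rewrite leq_addr.
move=> /IH /= H; apply: leq_trans H _; rewrite addnS -addSn leq_add2r.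
by case: (ctape c) => l h r; case: m => //=; [case: l|case: r => //= *; lia].
Qed.
End Code.

(** * Hitting dense sets *)

(** The first two terms of the binomial expansion. *)
Lemma expSn_ge A n : A ^ n.+1 + n.+1 * A ^ n <= A.+1 ^ n.+1.
Proof.
elim: n => [|n IH]; first by rewrite !expn1 expn0 addn1.
by rewrite (expnS A.+1) (expnS A n.+1); move: IH; rewrite expnS; nia.
Qed.

(** In other words, [(1 - 1/A)^A] is at most [1/2]. *)
Lemma pow_pred_half A : 0 < A -> 2 * A.-1 ^ A <= A ^ A.
Proof. by case: A => // A _ /=; apply: leq_trans (expSn_ge A A); rewrite expnS; nia. Qed.

Section Hitting.
Variables (W U : finType) (S : W -> U -> bool) (A D : nat).
Hypotheses (cardU : #|U| = A * D) (D_gt0 : 0 < D) (A_gt1 : 1 < A).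

Definition dense w := D <= #|[set x | S w x]|.
Definition missed (G : seq U) := [set w | dense w && ~~ has (S w) G].

(** Averaging: each missed dense set contains a fraction at least [1/A] of the points, so some point
    lies in at least that fraction of the missed sets. *)
Lemma greedy_step G : exists x, #|missed (x :: G)| * A <= #|missed G| * A.-1.
Proof.
have [x Hx] : exists x, #|missed G| <= #|[set w in missed G | S w x]| * A.
  apply: NNPP => H.
  have {}H x : #|[set w in missed G | S w x]| * A < #|missed G|.
    by rewrite ltnNge; apply/negP => Hx; apply: H; exists x.
  have Hsum : \sum_x #|[set w in missed G | S w x]| = \sum_(w in missed G) #|[set x | S w x]|.
    under eq_bigr => x _ do rewrite cardsE -sum1_card.
    under [RHS]eq_bigr => w _ do rewrite cardsE -sum1_card.
    rewrite (exchange_big_dep (fun w => w \in missed G)) /=; last by move=> ? ? _ /andP[].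
    apply: eq_bigr => w Hw; apply: eq_bigl => x.
    by rewrite unfold_in /= Hw.
  have Hlo : #|missed G| * D <= \sum_x #|[set w in missed G | S w x]|.
    rewrite Hsum -sum_nat_const; apply: leq_sum => w.
    by rewrite inE => /andP[].
  (* Every point falls short by at least one, and [U] is nonempty, so the sum contradicts [Hlo]. *)
  have Hhi : \sum_x (#|[set w in missed G | S w x]| * A + 1) <= \sum_(x : U) #|missed G|.
    by apply: leq_sum => x _; rewrite addn1; apply: H.
  by move: Hhi; rewrite big_split -big_distrl /= !sum_nat_const cardU; nia.
exists x.
have -> : missed (x :: G) = missed G :\: [set w in missed G | S w x].
  apply/setP => w; rewrite !inE /= negb_or.
  by case: (dense w); case: (S w x); case: (has _ G).
rewrite cardsD (setIidPr _); last by apply/subsetP => w; rewrite inE => /andP[].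
by rewrite mulnBl -subn1 mulnBr muln1 leq_sub2l.
Qed.

Lemma greedy k : exists2 G : seq U, size G = k & #|missed G| * A ^ k <= #|W| * A.-1 ^ k.
Proof.
elim: k => [|k [G <- IH]]; first by exists [::] => //; rewrite !muln1 max_card.
have [x Hx] := greedy_step G; exists (x :: G) => //=.
rewrite !expnS mulnA; apply: leq_trans (leq_mul Hx (leqnn _)) _.
by rewrite mulnAC (mulnC A.-1 (_ ^ _)) mulnA leq_mul2r IH orbT.
Qed.

(** After [A * s] greedy steps at most [#|W| * (1 - 1/A)^(A * s)] sets are missed, which is below
    1. *)
Lemma hitting_set s : #|W| < 2 ^ s ->
  exists2 G : seq U, size G = A * s & forall w, dense w -> has (S w) G.
Proof.
move=> HW; have [G HG H] := greedy (A * s); exists G => // w Hw; apply/negPn/negP => Hn.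
have H0 : 0 < #|missed G| by apply/card_gt0P; exists w; rewrite inE Hw.
move: H; rewrite !expnM.
have HA : 2 ^ s * (A.-1 ^ A) ^ s <= (A ^ A) ^ s.
  by rewrite -expnMn; case: s {HW HG} => // s; rewrite leq_exp2r // pow_pred_half //; lia.
have HP : 0 < (A.-1 ^ A) ^ s by rewrite !expn_gt0; lia.
move: (_ ^ s) (_ ^ s) (_ ^ s) HA HP HW H0 => a b c; nia.
Qed.
End Hitting.

(** * Random strings *)

Definition str n i := mkseq (fun k => odd (i %/ 2 ^ k)) n.

Lemma size_str n i : size (str n i) = n.
Proof. by rewrite size_mkseq. Qed.

(** Hence the encodings of the strings of length [n] are the numbers from [2 ^ n] up to, but
    excluding, [2 ^ n.+1]. *)
Lemma enc_str n i : i < 2 ^ n -> enc (str n i) = 2 ^ n + i.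
Proof.
rewrite /str /mkseq; elim: n i => [|n IH] i Hi /=; first by case: i Hi.
rewrite divn1 -[in iota 1 _](addn0 1) iotaDl -map_comp (eq_map (g := fun k => odd (i %/ 2 %/ 2 ^ k))); last first.
  by move=> k; rewrite /= -divnMA expnS.
rewrite IH; last by rewrite expnS in Hi; lia.
rewrite expnS; lia.
Qed.

Lemma str_inj n i j : i < 2 ^ n -> j < 2 ^ n -> str n i = str n j -> i = j.
Proof. by move=> Hi Hj E; have := enc_str Hi; rewrite E enc_str // => /addnI. Qed.

(** Printing the number that [kleene_normal_form] receives already reverses the input. *)
Lemma rev_machine : exists M : TM, forall p, outputs M p (rev p).
Proof.
have [M HM] := @kleene_normal_form (fun _ _ => true) (fun _ b => b) (pr_const 1) (pr_var 1).
exists M => p.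
by apply: (HM p 0).
Qed.

(* Programs printing the strings of length n - a are shorter than n, but print no
   string of length n. *)
Lemma random_dense U : universal U -> exists2 a, 0 < a & forall n (A : pred nat), a <= n ->
  (forall i, i < 2 ^ n -> R_K U (str n i) -> A i) -> 2 ^ (n - a) <= #|[set i : 'I_(2 ^ n) | A i]|.
Proof.
move=> HU; have [M HM] := rev_machine; have [c Hc] := HU M.
(* One more than the universality constant makes the programs for strings of length [n - c.+1]
   strictly shorter than [n]. *)
exists c.+1 => // n A Hn HA.
(* Programs shorter than [n] have encodings below [2 ^ n], so those of the strings outside [A] and
   those of the strings of length [n - c.+1] share the range ['I_(2 ^ n)]. For [i] in [A] the chosen
   value is arbitrary. *)
have Hg (i : 'I_(2 ^ n)) : exists k : 'I_(2 ^ n),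
    ~~ A i -> exists2 q, outputs U q (str n i) & enc q = k.
  case: (boolP (A i)) => HAi; first by exists i.
  have [q Hq Hs] : exists2 q, outputs U q (str n i) & size q < n.
    apply: NNPP => H; case/negP: HAi; apply: HA => // q Hq; rewrite size_str leqNgt.
    by apply/negP => Hs; apply: H; exists q.
  have Hk : enc q < 2 ^ n.
    by have /andP[_ H] := enc_size q; apply: leq_trans H _; rewrite leq_exp2l.
  by exists (Ordinal Hk) => _; exists q.
have Hh (i : 'I_(2 ^ (n - c.+1))) : exists k : 'I_(2 ^ n),
    exists2 q, outputs U q (str (n - c.+1) i) & enc q = k.
  have [q [Hq Hs]] := Hc _ _ (HM (rev (str (n - c.+1) i))).
  rewrite revK in Hq; rewrite size_rev size_str in Hs.
  have Hk : enc q < 2 ^ n.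
    by have /andP[_ H] := enc_size q; apply: leq_trans H _; rewrite leq_exp2l //; lia.
  by exists (Ordinal Hk); exists q.
have [g {}Hg] := fin_all_exists Hg; have [h {}Hh] := fin_all_exists Hh.
have same q q' y y' (k : 'I_(2 ^ n)) : outputs U q y -> enc q = k ->
    outputs U q' y' -> enc q' = k -> y = y'.
  by move=> H1 E1 H2 E2; apply: outputs_det H1 _; have -> : q = q' by apply: enc_inj; rewrite E1 E2.
have Ig : {in ~: [set i : 'I_(2 ^ n) | A i] &, injective g}.
  move=> i j; rewrite !inE => /Hg [q Hq Eq] /Hg [q' Hq' Eq'] E; rewrite -E in Eq'.
  by apply/val_inj/(str_inj (ltn_ord i) (ltn_ord j)); apply: same Hq Eq Hq' Eq'.
have Ih : injective h.
  move=> i j E; have [q Hq Eq] := Hh i; have [q' Hq' Eq'] := Hh j; rewrite -E in Eq'.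
  by apply/val_inj/(str_inj (ltn_ord i) (ltn_ord j)); apply: same Hq Eq Hq' Eq'.
(* A common value would be a program with outputs of two different lengths. *)
have Hdis : [disjoint g @: (~: [set i : 'I_(2 ^ n) | A i]) & h @: setT].
  apply/pred0P => k /=; apply/negP => /andP[/imsetP[i]]; rewrite !inE => /Hg [q Hq Eq] -> .
  move=> /imsetP[j _ E]; have [q' Hq' Eq'] := Hh j; rewrite -E in Eq'.
  have := congr1 size (same _ _ _ _ _ Hq Eq Hq' Eq'); rewrite !size_str; lia.
have := max_card (g @: (~: [set i : 'I_(2 ^ n) | A i]) :|: h @: setT).
rewrite cardsU disjoint_setI0 // cards0 subn0 card_in_imset // card_imset // cardsT !card_ord.
by have := cardsC [set i : 'I_(2 ^ n) | A i]; rewrite card_ord; lia.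
Qed.

(** * The search predicate and the decoding of programs *)

(* [s] pairs a time bound with a list of encoded strings; [w] pairs the code of a
   machine with the encoding of an advice. *)
Definition accepted s w X := nsim (pi1 w) X (pi2 w) (pi1 s).+2 == 2.

(* A program [N = 2^e (2 J + 1)] with [J = 2^j + i] asks for element [i] of the list
   for length [n = j + 2 e]. *)
Definition arg_e N := logn 2 N.
Definition arg_J N := N %/ 2 ^ (arg_e N).+1.
Definition arg_j N := trunc_log 2 (arg_J N).
Definition arg_n N := arg_j N + 2 * arg_e N.

(** The two bounds on the list entry ensure that it encodes a string of length [n]. *)
Definition hits a s n j w := (2 ^ (n - a) <= \sum_(i < 2 ^ n) accepted s w (2 ^ n + i)) ==>
  bex (2 ^ j) (fun i => [&& 2 ^ n <= nthp (pi2 s) i, nthp (pi2 s) i < 2 ^ n.+1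
                          & accepted s w (nthp (pi2 s) i)]).

(** The number [(2 ^ n.+1).-1] encodes [n] ones and [1] the empty advice: the first conjunct says
    that the machine coded by [Dt] halts on [n] in unary with fuel [pi1 s]. *)
Definition good Dt a s n j := (nsim Dt (2 ^ n.+1).-1 1 (pi1 s).+1 != 0) &&
  ball (2 ^ (2 ^ (j - a))).-1 (hits a s n j).

Definition answer s N := nthp (pi2 s) (arg_J N - 2 ^ arg_j N).

Lemma pr_arg_e f : PR f -> PR (fun s => arg_e (f s)).
Proof. exact: pr_logn2. Qed.

Lemma pr_arg_J f : PR f -> PR (fun s => arg_J (f s)).
Proof. by move=> Hf; have He := pr_arg_e Hf; rewrite /arg_J; pr. Qed.

Lemma pr_arg_j f : PR f -> PR (fun s => arg_j (f s)).
Proof. by move=> /pr_arg_J; apply: pr_trunc_log2. Qed.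

Lemma pr_arg_n f : PR f -> PR (fun s => arg_n (f s)).
Proof.
by move=> Hf; have He := pr_arg_e Hf; have Hj := pr_arg_j Hf; rewrite /arg_n; pr.
Qed.

Lemma pr_accepted f g h : PR f -> PR g -> PR h -> PR (fun s => accepted (f s) (g s) (h s)).
Proof. by move=> Hf Hg Hh; rewrite /accepted; pr; apply: pr_nsim; pr. Qed.

Lemma pr_hits a f g h k : PR f -> PR g -> PR h -> PR k ->
  PR (fun s => hits a (f s) (g s) (h s) (k s)).
Proof.
apply: (pr_comp4 (G := fun s n j w => hits a s n j w : nat)); rewrite /hits.
apply: pr_imp.
  apply: pr_leq; first by pr.
  apply: (@pr_sum _ (fun s i => accepted (s 0) (s 3) (2 ^ s 1 + i) : nat)); first by pr.
  by apply: pr_accepted; pr.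
apply: (@pr_bex _ (fun s i => [&& 2 ^ s 1 <= nthp (pi2 (s 0)) i, nthp (pi2 (s 0)) i < 2 ^ (s 1).+1
                          & accepted (s 0) (s 3) (nthp (pi2 (s 0)) i)])); first by pr.
by pr; apply: pr_accepted; pr.
Qed.

Lemma pr_good Dt a : PR (fun s => good Dt a (s 0) (arg_n (s 1)) (arg_j (s 1))).
Proof.
apply: (pr_comp3 (G := fun s n j => good Dt a s n j : nat)); [|by pr|by apply: pr_arg_n; pr|by apply: pr_arg_j; pr].
rewrite /good; apply: pr_and; first by pr; apply: pr_nsim; pr.
apply: (@pr_ball _ (fun s => hits a (s 0) (s 1) (s 2))); first by pr.
by apply: pr_hits; pr.
Qed.

Lemma pr_answer : PR (fun s => answer (s 0) (s 1)).
Proof.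
rewrite /answer; pr; first by apply: pr_arg_J; pr.
by apply: pr_arg_j; pr.
Qed.

(** The odd factor makes [e] the 2-adic valuation of [N], and the leading [2 ^ j] makes [j] the
    binary logarithm of [arg_J N]. *)
Lemma argP e j i : i < 2 ^ j -> let N := 2 ^ e * (2 * (2 ^ j + i)).+1 in
  [/\ arg_e N = e, arg_J N = 2 ^ j + i & arg_j N = j].
Proof.
move=> Hi N.
have He : arg_e N = e.
  rewrite /arg_e /N lognM // ?expn_gt0 // lognX logn_prime // muln1.
  by rewrite -[RHS]addn0; congr (_ + _); rewrite lognE /= dvdn2 /= oddM.
have HJ : arg_J N = 2 ^ j + i.
  by rewrite /arg_J He /N expnSr divnMA mulKn ?expn_gt0 //; lia.
split=> //; rewrite /arg_j HJ; apply: trunc_log_eq => //.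
by rewrite leq_addr expnS; lia.
Qed.

Lemma nat_enc N : 0 < N -> exists p, enc p = N.
Proof.
elim/ltn_ind: N => N IH HN; case: (leqP N 1) => H; first by exists [::] => /=; lia.
have [||p Hp] := IH (N./2); try lia.
exists (odd N :: p); rewrite /= Hp; lia.
Qed.

Theorem mainTheorem3 (U : TM) (HU : universal U)
  (t : nat -> nat) (Ht : computable_nat_fun t) :
  exists d : nat, ~ io_DTIME_advice t (fun n => 2 ^ (n - d)) (R_K U).
Proof.
have [Mt HMt] := Ht; have [a a_gt0 Hdense] := random_dense HU.
have [P HP] := @kleene_normal_form (fun s N => good (code Mt) a s (arg_n N) (arg_j N)) answer
  (pr_good (code Mt) a) pr_answer.
have [c Hc] := HU P.
(* Elements of the list will have complexity at most [e + j + 1 + c], which is below [n = j + 2 * e]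
   for this [e]. The rest of the constant gives [j - a = m + 2], where [2 ^ m] bounds the advice
   length. *)
pose e := c + 2; exists (2 * e + a + 2) => -[M [Hhalt [alpha [Halpha Hio]]]].
pose D := code M.
have [n [Hn HM]] := Hio (2 * e + a + 2 + D + 2).
pose m := n - (2 * e + a + 2); pose j := n - 2 * e.
pose beta := alpha n; pose w := pair D (enc beta).
have Hm : m >= D + 2 by rewrite /m; lia.
have Hj : j - a = m + 2 by rewrite /j /m; lia.
have Ejn : j + 2 * e = n by rewrite /j; lia.
pose x0 := nseq n true.
(* Both [D] and [enc beta] are below [2 ^ (2 ^ m + 1)], and [pair] roughly squares their sum; the
   exponent [2 * 2 ^ m + 4] stays below [2 ^ (m + 2)]. *)
have Hw : w < (2 ^ (2 ^ (j - a))).-1.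
  have Hv : enc beta < 2 ^ (2 ^ m + 1).
    have /andP[_ H] := enc_size beta; apply: leq_trans H _; rewrite leq_exp2l //.
    by have := Halpha n; rewrite -/m -/beta; lia.
  have Hpow : m < 2 ^ m by apply: ltn_expl.
  have HD : D < 2 ^ (2 ^ m + 1).
    by apply: leq_trans (ltn_expl D (isT : 1 < 2)) _; rewrite leq_exp2l //; lia.
  have H4 : 4 <= 2 ^ m by apply: (@leq_trans (2 ^ 2)) => //; rewrite leq_exp2l //; lia.
  have Hlt : (D + enc beta).+1 <= 2 ^ (2 ^ m + 1 + 1).
    by rewrite [X in _ <= X]expnD expn1; lia.
  rewrite Hj; suff : w.+1 < 2 ^ 2 ^ (m + 2) by lia.
  have : (D + enc beta).+1 ^ 2 < 2 ^ 2 ^ (m + 2).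
    apply: (@leq_ltn_trans ((2 ^ (2 ^ m + 1 + 1)) ^ 2)); first by rewrite leq_exp2r.
    rewrite -expnM ltn_exp2l // expnD; lia.
  by apply: leq_ltn_trans; rewrite /w /pair; nia.
have Ex0 : (2 ^ n.+1).-1 = enc x0.
  by rewrite /x0; elim: (n) => //= l <-; rewrite !expnS; have := expn_gt0 2 l; lia.
(* [accepted] makes [(pi1 s).+2] interpreter steps, that is, it runs with fuel [(pi1 s).+1], enough
   for [M] to halt. *)
have acceptedE s X : t n <= (pi1 s).+1 -> X < 2 ^ n ->
    accepted s w (2 ^ n + X) <-> R_K U (str n X).
  move=> HT HX; have Hsz := size_str n X.
  rewrite (HM _ Hsz) /accepted /w !pi1_pair pi2_pair -enc_str // nsimP.
  have [[b tp'] Hb] := Hhalt (str n X) beta; rewrite Hsz in Hb.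
  rewrite (run_mono HT Hb); split=> [|[n1 [tp1 H1]]].
    by case: b Hb => // Hb _; exists (t n), tp'.
  by have [<- _] := run_det H1 Hb.
have sumE s w' : \sum_(i < 2 ^ n) accepted s w' (2 ^ n + i) =
    #|[set i : 'I_(2 ^ n) | accepted s w' (2 ^ n + i)]|.
  by rewrite -sum1dep_card [RHS]big_mkcond; apply: eq_bigr => i _; case: accepted.
have Hgood : exists s, good (code Mt) a s n j.
  have [n0 [acc [tp [Hrun _]]]] := HMt n.
  (* Acceptance depends on [s] only through its time bound, which can therefore be fixed before the
     list is chosen. *)
  pose acc0 w' X := accepted (pair n0 0) w' X.
  have accE G w' X : accepted (pair n0 G) w' X = acc0 w' X by rewrite /acc0 /accepted !pi1_pair.
  have Hcard : #|'I_(2 ^ n)| = 2 ^ a * 2 ^ (n - a) by rewrite card_ord -expnD subnKC //; lia.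
  have Ha : 1 < 2 ^ a by rewrite -[X in X < _](expn0 2) ltn_exp2l.
  (* Density [1 / 2 ^ a] against fewer than [2 ^ (2 ^ (j - a))] sets: the list has
     [2 ^ a * 2 ^ (j - a) = 2 ^ j] elements. *)
  have [||G HG Hhit] := @hitting_set 'I_(2 ^ (2 ^ (j - a))).-1 _
    (fun (w' : 'I_(2 ^ (2 ^ (j - a))).-1) (i : 'I_(2 ^ n)) => acc0 w' (2 ^ n + i)) _ _ Hcard _ Ha (2 ^ (j - a)).
  - by rewrite expn_gt0.
  - by rewrite card_ord; have := expn_gt0 2 (2 ^ (j - a)); lia.
  have {}HG : size G = 2 ^ j by rewrite HG -expnD subnKC //; lia.
  exists (pair n0 (foldr pair 0 [seq 2 ^ n + val i | i <- G])).
  rewrite /good pi1_pair; apply/andP; split.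
    by rewrite Ex0 -[1]/(enc [::]) nsimP Hrun.
  apply/ballP => w' Hw'; apply/implyP; rewrite sumE => Hd.
  have [|X HX HXa] := hasP (Hhit (Ordinal Hw') _).
    by apply: leq_trans Hd _; apply/subset_leq_card/subsetP => i; rewrite !inE accE.
  apply/bexP; exists (index X G); first by rewrite -HG index_mem.
  have -> : nthp (pi2 (pair n0 (foldr pair 0 [seq 2 ^ n + val i | i <- G]))) (index X G) = 2 ^ n + X.
    rewrite pi2_pair nthp_foldr; last by rewrite size_map index_mem.
    by rewrite (nth_map X) ?index_mem // nth_index.
  rewrite leq_addr accE HXa /= expnS.
  by have := ltn_ord X; lia.
(* The least [s] depends only on [n] and [j], so the programs for all indices find the same list. *)
case: (ex_minnP Hgood) => s Hs Hmin.
have /andP[Hfuel /ballP /(_ w Hw) Hhits] := Hs.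
(* The output of length [t n] lies on the head cell and the right half, which has at most [pi1 s]
   cells. *)
have Ht_le : t n <= (pi1 s).+1.
  move: Hfuel; rewrite Ex0 -[1]/(enc [::]) nsimP.
  case Hrun : (run _ _ _ _ _) => [[acc tp]|] // _.
  have [n0 [acc0 [tp0 [Hrun0 Hout]]]] := HMt n.
  have [_ Etp] := run_det Hrun0 Hrun.
  rewrite -(size_nseq (t n) true) -Hout Etp; apply: leq_trans (size_out_bits _) _.
  by rewrite /= ltnS; have := run_size Hrun.
move: Hhits; rewrite /hits sumE (Hdense n (fun i => accepted s w (2 ^ n + i))); last 2 first.
- by lia.
- by move=> i Hi HR; apply/acceptedE.
move=> /bexP[i Hi /and3P[Hlo Hhi Hacc]].
set X := nthp _ _ in Hlo Hhi Hacc.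
have HX : X - 2 ^ n < 2 ^ n by rewrite expnS in Hhi; lia.
have EX : X = 2 ^ n + (X - 2 ^ n) by lia.
rewrite EX acceptedE // in Hacc.
have [Ee EJ Ej] := argP e Hi.
have [|p Hp] := @nat_enc (2 ^ e * (2 * (2 ^ j + i)).+1); first by rewrite muln_gt0 expn_gt0.
(* Besides the index of [j] bits, the program spends [e] bits on [e] in unary and one separating
   bit. *)
have Hsize : size p <= e + j + 1.
  have /andP[H _] := enc_size p.
  suff : 2 ^ size p < 2 ^ (e + j + 2) by rewrite ltn_exp2l //; lia.
  apply: leq_ltn_trans H _; rewrite Hp -addnA !expnD ltn_pmul2l ?expn_gt0 //; lia.
have Hout : outputs P (rev p) (str n (X - 2 ^ n)).
  (* The program is reversed to undo the reversal in [kleene_normal_form]. *)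
  apply: (HP _ s); rewrite revK Hp /answer /arg_n ?EJ Ej ?Ee ?Ejn.
  - exact: Hs.
  - by move=> s' Hs'; apply/negP => /Hmin; lia.
  - by rewrite addKn -/X enc_str -?EX.
have [q [Hq Hqs]] := Hc _ _ Hout.
have := Hacc q Hq; rewrite size_str; rewrite size_rev in Hqs; rewrite /e in Hsize Ejn *; lia.
Qed.
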